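(* If there exists a $\mathcal K$-Lusin set of uncountable cardinality $\kappa$, then for every infinite ordinal $\lambda<\mathfrak c^+$ with $\mathrm{cf}(\lambda)\le\omega$ and $\mathrm{cf}(\lim\lambda)\le\kappa$ there exists a separable special FLS space of cardinality $\mathfrak c$ and scattered height $\lambda$.
   Context: $\mathfrak c$ is the cardinality of the continuum and $\mathfrak c^+$ its successor cardinal. $\omega^\omega$ carries the product topology ($\omega$ discrete). A $\mathcal K$-Lusin set is a set $L\subseteq\omega^\omega$ such that $K\cap L$ is countable for every compact $K\subseteq\omega^\omega$. Every ordinal $\lambda$ is uniquely $\lambda=\mu+n$ with $\mu$ a limit ordinal ($0$ counts as limit) and $n\in\omega$; $\lim\lambda:=\mu$. $\mathrm{cf}$ is cofinality, with $\mathrm{cf}(0)=0$ and $\mathrm{cf}(\lambda)=1$ for successor $\lambda$. Each ordinal is identified with the set of smaller ordinals. All spaces are Hausdorff topological spaces. For a space $X$, $X^{(1)}$ is the set of non-isolated points of $X$; $X^{(0)}=X$ and $X^{(\alpha)}=\bigcap_{\xi<\alpha}(X^{(\xi)})^{(1)}$ for ordinals $\alpha>0$. $X$ is scattered if every nonempty subspace has an isolated point; the scattered height of a scattered space $X$ is the smallest ordinal $\alpha$ with $X^{(\alpha)}=\emptyset$. An FLS space is a first-countable Lindelöf scattered (Hausdorff) space. Scattered modifications: let $(X,\tau)$ be a nonempty topological space. A height function on $X$ is a surjective function $h:X\to h[X]$ onto an ordinal $h[X]$ such that for every $\alpha\in h[X]$ the set $h^{-1}\{\alpha\}$ is dense in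 $\{x\in X: h(x)\ge\alpha\}$. The scattered $h$-modification $X_h$ of $X$ is the set $X$ with the topology generated by the base of sets $B_h(x;U)=\{x\}\cup\{y\in U:h(y)<h(x)\}$, where $x\in U\in\tau$. A scattered space is special if it is homeomorphic to a scattered modification of some metrizable space. *)

(* Defs.v *)
From HB Require Import structures.
From mathcomp Require Import all_boot all_order all_algebra.
From mathcomp Require Import all_classical all_reals all_analysis.

Set Implicit Arguments.
Unset Strict Implicit.
Unset Printing Implicit Defensive.

Local Open Scope classical_set_scope.
Local Open Scope card_scope.

(** * Ordinals *)

(* An ordinal is represented by a well-ordered type.  Equality of ordinals is
   [ord_iso], and the members of an ordinal [a] correspond to its proper
   initial segments [ord_seg x]. *)
Record Ord := MkOrd {
  ord_sort :> Type;
  olt : ord_sort -> ord_sort -> Prop;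
  olt_wf : well_founded olt;
  olt_trans : forall x y z, olt x y -> olt y z -> olt x z;
  olt_total : forall x y, [\/ olt x y, x = y | olt y x] }.

Arguments olt {o} x y : rename.

Definition ole (a : Ord) (x y : a) := olt x y \/ x = y.

Definition ord_iso (a b : Ord) :=
  exists2 f : a -> b, bijective f & forall x y, olt x y <-> olt (f x) (f y).

Section Segment.
Variables (a : Ord) (x : a).

Let seg := {y : a | olt y x}.
Let slt (u v : seg) := olt (sval u) (sval v).

Lemma seg_wf : well_founded slt.
Proof.
move=> [y yx]; elim/(well_founded_ind (olt_wf (o := a))): y yx => y IH yx.
by constructor=> -[z zx] zy; exact: IH.
Qed.

Lemma seg_trans u v w : slt u v -> slt v w -> slt u w.
Proof. exact: olt_trans. Qed.

Lemma seg_total u v : [\/ slt u v, u = v | slt v u].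
Proof.
case: (olt_total (sval u) (sval v)) => h; [exact: Or31| |exact: Or33].
by apply: Or32; apply: eq_sig_hprop h => z; exact: Prop_irrelevance.
Qed.

Definition ord_seg : Ord := MkOrd seg_wf seg_trans seg_total.

End Segment.

Definition ord_lt (a b : Ord) := exists y : b, ord_iso a (ord_seg y).
Definition ord_le (a b : Ord) := ord_lt a b \/ ord_iso a b.

Section Successor.
Variable a : Ord.

(* [None] is the new greatest element. *)
Definition succ_lt (u v : option a) :=
  match u, v with
  | Some x, Some y => olt x y
  | Some _, None => True
  | None, _ => False
  end.

Lemma succ_wf : well_founded succ_lt.
Proof.
have wS (x : a) : Acc succ_lt (Some x).
  by elim/(well_founded_ind (olt_wf (o := a))): x => x IH; constructor=> -[y /IH|].
by move=> [x|]; [exact: wS|constructor=> -[y _|//]; exact: wS].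
Qed.

Lemma succ_trans u v w : succ_lt u v -> succ_lt v w -> succ_lt u w.
Proof. by case: u v w => [x|] [y|] [z|] //=; exact: olt_trans. Qed.

Lemma succ_total u v : [\/ succ_lt u v, u = v | succ_lt v u].
Proof.
case: u v => [x|] [y|] /=; [|exact: Or31|exact: Or33|exact: Or32].
by case: (olt_total x y) => [|->|]; [exact: Or31|exact: Or32|exact: Or33].
Qed.

Definition ord_succ : Ord := MkOrd succ_wf succ_trans succ_total.

End Successor.

Fixpoint ord_addn (a : Ord) (n : nat) : Ord :=
  if n is m.+1 then ord_succ (ord_addn a m) else a.

(* 0 is a limit ordinal. *)
Definition is_limit (a : Ord) := ~ exists b : Ord, ord_iso a (ord_succ b).

(* [is_lim l m] : m = lim l *)
Definition is_lim (l m : Ord) :=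
  is_limit m /\ exists n : nat, ord_iso l (ord_addn m n).

Lemma omega_wf : well_founded (fun m n : nat => is_true (m < n)).
Proof.
suff H n k : (k <= n)%N -> Acc (fun m n : nat => is_true (m < n)) k.
  by move=> n; exact: (H n n (leqnn n)).
elim: n k => [|n IH] k kn; constructor=> m mk.
  by move: (leq_trans mk kn); rewrite ltn0.
by apply: IH; rewrite -ltnS; exact: leq_trans mk kn.
Qed.

Lemma omega_trans (m n p : nat) : m < n -> n < p -> m < p.
Proof. exact: ltn_trans. Qed.

Lemma omega_total (m n : nat) : [\/ m < n, m = n | n < m].
Proof. by case: (ltngtP m n) => h; [exact: Or31|exact: Or33|exact: Or32]. Qed.

Definition omega : Ord := MkOrd omega_wf omega_trans omega_total.

(** * Cardinals, as initial ordinals *)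

Definition is_cardinal (k : Ord) :=
  forall b : Ord, ord_lt b k -> ~ ([set: b] #= [set: k]).

(* [is_card A k] : k = |A| *)
Definition is_card (T : Type) (A : set T) (k : Ord) :=
  is_cardinal k /\ [set: k] #= A.

(* [is_succ_cardinal k k'] : k' is the least cardinal greater than k *)
Definition is_succ_cardinal (k k' : Ord) :=
  [/\ is_cardinal k', ord_lt k k' &
      forall b : Ord, is_cardinal b -> ord_lt k b -> ord_le k' b].

Definition cofinal (a : Ord) (A : set a) := forall x, exists2 y, A y & ole x y.

(* [is_cf a k] : k = cf a.  This gives cf 0 = 0 and cf (b + 1) = 1. *)
Definition is_cf (a k : Ord) :=
  (exists2 A : set a, cofinal A & is_card A k) /\
  (forall (A : set a) (b : Ord), cofinal A -> is_card A b -> ord_le k b).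

(** * Topology *)

Definition K_Lusin (L : set {ptws nat -> nat}) :=
  forall K : set {ptws nat -> nat}, compact K -> countable (K `&` L).

Definition homeomorphic (X Y : topologicalType) :=
  exists (f : X -> Y) (g : Y -> X),
    [/\ cancel f g, cancel g f, continuous f & continuous g].

Definition metrizable (R : realType) (X : topologicalType) :=
  exists M : metricType R, homeomorphic X M.

Definition first_countable (X : topologicalType) :=
  forall x : X, exists B : set (set X),
    [/\ countable B, B `<=` nbhs x &
        forall U, nbhs x U -> exists2 V, B V & V `<=` U].

Definition lindelof (X : topologicalType) :=
  forall C : set (set X), C `<=` open -> \bigcup_(U in C) U = setT ->
    exists D : set (set X),
      [/\ D `<=` C, countable D & \bigcup_(U in D) U = setT].

Definition separable (X : topologicalType) :=
  exists2 D : set X, countable D & dense D.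

Definition scattered (X : topologicalType) :=
  forall A : set X, A !=set0 -> isolated A !=set0.

(* A^(1), for A with the subspace topology *)
Definition derived (X : topologicalType) (A : set X) : set X :=
  A `\` isolated A.

(* [cb X x] is X^(x), where x is identified with the ordinal of its
   predecessors; see [cbE] and [cb_derivative_seg]. *)
Definition cb (X : topologicalType) (a : Ord) : a -> set X :=
  Fix (olt_wf (o := a)) (fun _ => set X)
    (fun x rec => [set p | forall y (yx : olt y x), derived (rec y yx) p]).
Arguments cb X {a} x.

Lemma cbE (X : topologicalType) (a : Ord) (x : a) :
  cb X x = \bigcap_(y in [set y | olt y x]) derived (cb X y).
Proof.
rewrite /cb Fix_eq; first by apply/seteqP; split=> p H y; apply: H.
move=> y f g fg; suff -> : f = g by [].
by apply: functional_extensionality_dep => z; apply: funext => zy; exact: fg.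
Qed.

(* X^(a); the intersection is X when a = 0 *)
Definition cb_derivative (X : topologicalType) (a : Ord) : set X :=
  \bigcap_(x in [set: a]) derived (cb X x).
Arguments cb_derivative X a : clear implicits.

Lemma cb_segE (X : topologicalType) (a : Ord) (x : a) (z : ord_seg x) :
  cb X z = cb X (sval z).
Proof.
elim/(well_founded_ind (@olt_wf (ord_seg x))): z => z IH.
rewrite !cbE; apply/seteqP; split=> p H y yz; last by rewrite IH //; exact: H.
have yx : olt y x by exact: olt_trans yz (svalP z).
by have := H (exist _ y yx) yz; rewrite IH.
Qed.

Lemma cb_derivative_seg (X : topologicalType) (a : Ord) (x : a) :
  cb_derivative X (ord_seg x) = cb X x.
Proof.
rewrite /cb_derivative cbE; apply/seteqP; split=> p H y yz.
  by have := H (exist _ y yz) Logic.I; rewrite cb_segE.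
by rewrite cb_segE; apply: H; exact: svalP.
Qed.

Definition scattered_height (X : topologicalType) (a : Ord) :=
  [/\ scattered X, cb_derivative X a = set0 &
      forall b : Ord, cb_derivative X b = set0 -> ord_le a b].

Definition FLS (X : topologicalType) :=
  [/\ hausdorff_space X, first_countable X, lindelof X & scattered X].

(** * Scattered modifications *)

Definition height_function (X : topologicalType) (a : Ord) (h : X -> a) :=
  (forall y : a, exists x : X, h x = y) /\
  (forall y : a, [set x | ole y (h x)] `<=` closure (h @^-1` [set y])).

Definition scattered_modification (X : topologicalType) (a : Ord)
  (h : X -> a) : Type := X.

Section ScatteredModification.
Variables (X : topologicalType) (a : Ord) (h : X -> a).

Definition smod_basic (x : X) (U : set X) : set X :=
  [set x] `|` [set y | U y /\ olt (h y) (h x)].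

Definition smod_base : set (set X) :=
  [set B | exists x U, [/\ open U, U x & B = smod_basic x U]].

Lemma smod_cover : \bigcup_(B in smod_base) B = setT.
Proof.
apply/seteqP; split=> // x _; exists (smod_basic x setT); last by left.
by exists x, setT; split=> //; exact: openT.
Qed.

Lemma smod_join (B C : set X) (z : X) :
  smod_base B -> smod_base C -> B z -> C z ->
  exists D, [/\ smod_base D, D z & D `<=` B `&` C].
Proof.
have key x U : U x -> smod_basic x U z ->
    U z /\ (forall w, U w -> olt (h w) (h z) -> smod_basic x U w) .
  move=> Ux [->|[Uz zx]]; first by split=> // w Uw wx; right.
  by split=> // w Uw wz; right; split=> //; exact: olt_trans wz zx.
move=> [x [U [oU Ux ->]]] [y [V [oV Vy ->]]] Bz Cz.
have [Uz KU] := key _ _ Ux Bz; have [Vz KV] := key _ _ Vy Cz.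
exists (smod_basic z (U `&` V)); split; last 2 first.
- by left.
- move=> w [->//|[[Uw Vw] wz]]; split; [exact: KU|exact: KV].
- by exists z, (U `&` V); split=> //; exact: openI.
Qed.

HB.instance Definition _ := Choice.on (scattered_modification h).
HB.instance Definition _ := isBaseTopological.Build (scattered_modification h)
  smod_cover smod_join.

End ScatteredModification.

Definition special (R : realType) (X : topologicalType) :=
  scattered X /\
  exists (M : topologicalType) (a : Ord) (h : M -> a),
    [/\ [set: M] !=set0, metrizable R M, height_function h &
        homeomorphic X (scattered_modification h)].

(* Main.v *)
Require Import Defs.
From HB Require Import structures.
From mathcomp Require Import all_boot all_order all_algebra.
From mathcomp Require Import all_classical all_reals all_analysis.

(** The space is a scattered modification of a subspace of the Cantor space.

   Each [x] in the Cantor space has a trace, a subset of [nat], and the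
   subspace consists of the eventually constant points and of the fibres of the
   trace over a family [LL] of infinite sets.  Write [lambda] as a limit ordinal
   [mu] followed by finitely many top heights.  Height 0 is given to the
   countable dense set of eventually true points, the top heights (or 0, if
   there are none) to the countably many eventually false points, and the
   heights in [mu] are spread over the fibres.

   Heights within a fibre come from a Bernstein decomposition, that is, a map [b]
   from the Cantor space to [lambda] whose fibres all meet every uncountable
   closed set ([bernstein]).  It exists because [lambda] has at most continuum many
   elements and uncountable closed sets have exactly continuum many
   ([uncountable_closed_inj]).  The heights allowed in a fibre are those below
   some term of a sequence without maximum, its ladder.  Open sets around all
   the points of one height contain all but countably many points of the fibre,
   so in the modified topology the neighbourhoods of the points of that height
   cover all but countably many of the lower points.  The ladder being
   countable and cofinal in these heights, the fibre is Lindelof, no matter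
   how many heights it carries ([fiber_lindelof]).

   It remains to control the number of fibres ([Y_lindelof]).  If [mu] has
   countable cofinality, all fibres can use the same ladder, cofinal in [mu],
   and [LL] can be countable ([countable_cofinal_ladders]).  Otherwise [lambda]
   is a successor, as its cofinality is countable, so the eventually false points
   lie above all fibres.  Open sets around them leave a compact set of infinite
   subsets of [nat] as traces ([word_nbhs_hits]).  Now [LL] is obtained from the
   K-Lusin set by coding and by closing under finite changes, so only countably
   many traces in [LL] remain, while [LL] is still large enough for the ladders
   to be unbounded in [mu] ([K_Lusin_ladders]): this is where the bound on the
   cofinality of [mu] enters.

   Every height is dense among the points of at least that height, because
   uncountable closed pieces of the fibres meet all allowed heights and the ladders
   above a given height have dense traces.  Then the Cantor-Bendixson
   derivatives are the sets of points of height at least [y] ([smod_cbE]), the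
   scattered height is [lambda], and separability comes from the level 0. *)

Set Implicit Arguments.
Unset Strict Implicit.
Unset Printing Implicit Defensive.

Local Open Scope classical_set_scope.
Local Open Scope card_scope.

(** * Injections and countable sets *)

Lemma card_le_injP (T U : Type) :
  [set: T] #<= [set: U] <-> exists f : T -> U, injective f.
Proof.
split=> [/card_leP/injfunPex[f _ fi]|[f fi]].
  exists (fun x => val (f (to_setT x))) => x y /val_inj fxy.
  by have /(congr1 val) := fi _ _ (in_setT _) (in_setT _) fxy.
apply/card_leP/injfunPex; exists (fun x => to_setT (f (val x))) => //.
by move=> x y _ _ /(congr1 val)/fi/val_inj.
Qed.

Lemma inj_surj_bij (T U : Type) (f : T -> U) :
  injective f -> (forall y, exists x, f x = y) -> bijective f.
Proof.
by move=> finj /choice[g fg]; exists g => // x; exact/finj/fg.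
Qed.

Lemma inj_retraction (T U : Type) (f : T -> U) (t : T) :
  injective f -> exists g : U -> T, cancel f g.
Proof.
move=> finj; have /choice[g gP] : forall u, exists x, range f u -> f x = u.
  by move=> u; have [[x _ xu]|nu] := pselect (range f u); [exists x|exists t].
by exists g => x; apply: finj; apply: gP; exists x.
Qed.

Lemma countable_setU (T : Type) (A B : set T) :
  countable A -> countable B -> countable (A `|` B).
Proof.
move=> cA cB; have -> : A `|` B = \bigcup_d (if d then A else B).
  by apply/seteqP; split=> [y [?|?]|y [[] _ ?]]; [exists true|exists false|left|right].
by apply: bigcup_countable => // -[].
Qed.

Lemma countable_enum (T : Type) (A : set T) x0 : A x0 -> countable A ->
  exists f : nat -> T, (forall n, A (f n)) /\ forall x, A x -> exists n, f n = x.
Proof.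
move=> Ax0 /countable_injP[g gi].
have /choice[f fP] : forall n, exists x, A x /\ forall x', A x' -> g x' = n -> x' = x.
  move=> n; have [[x [Ax gx]]|nx] := pselect (exists x, A x /\ g x = n).
    exists x; split=> // x' Ax' gx'; apply: gi; rewrite ?inE //.
    by rewrite gx gx'.
  by exists x0; split=> // x' Ax' gx'; case: nx; exists x'.
exists f; split=> [n|x Ax]; first by case: (fP n).
by exists (g x); have [_ /(_ x Ax erefl)] := fP (g x).
Qed.

(** * Well-orders *)

Section OrdBasics.
Implicit Types a b c : Ord.

Lemma olt_irr a (x : a) : ~ olt x x.
Proof.
elim/(well_founded_ind (@olt_wf a)): x => x IH xx; exact: (IH x xx xx).
Qed.

Lemma olt_asym a (x y : a) : olt x y -> ~ olt y x.
Proof. by move=> xy /(olt_trans xy); exact: olt_irr. Qed.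

Lemma oleNlt a (x y : a) : ole x y <-> ~ olt y x.
Proof.
split=> [[xy|->]|]; [exact: olt_asym|exact: olt_irr|].
by case: (olt_total x y) => [xy _|-> _|//]; [left|right].
Qed.

Lemma ole_ltF a (x y : a) : ole x y -> olt y x -> False.
Proof. by move/oleNlt. Qed.

Lemma ole_lt_trans a (x y z : a) : ole x y -> olt y z -> olt x z.
Proof. by move=> [xy|->//]; exact: olt_trans. Qed.

Lemma olt_le_trans a (x y z : a) : olt x y -> ole y z -> olt x z.
Proof. by move=> xy [|<-//]; exact: olt_trans. Qed.

Lemma olt_min a (P : set a) x : P x ->
  exists2 y, P y & forall z, P z -> ole y z.
Proof.
elim/(well_founded_ind (@olt_wf a)): x => x IH Px.
have [[y [yx Py]]|nP] := pselect (exists y, olt y x /\ P y); first exact: (IH y).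
by exists x => // y Py; apply/oleNlt => yx; apply: nP; exists y.
Qed.

Definition initial_embedding a b (f : a -> b) :=
  (forall x y, olt x y -> olt (f x) (f y)) /\
  (forall x y, olt y (f x) -> exists z, f z = y).

Lemma olt_mono_inj a b (f : a -> b) :
  (forall x y, olt x y -> olt (f x) (f y)) -> injective f.
Proof.
move=> fm x y fxy; case: (olt_total x y) => // /fm; rewrite fxy => h;
  by case: (olt_irr h).
Qed.

Lemma olt_monoE a b (f : a -> b) :
  (forall x y, olt x y -> olt (f x) (f y)) ->
  forall x y, olt (f x) (f y) <-> olt x y.
Proof.
move=> fm x y; split=> [fxy|]; last exact: fm.
case: (olt_total x y) => // [xy|/fm yx]; last by case: (olt_asym fxy).
by move: fxy; rewrite xy => /olt_irr.
Qed.

Lemma olt_mono_le a (f : a -> a) :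
  (forall x y, olt x y -> olt (f x) (f y)) -> forall x, ole x (f x).
Proof.
move=> fm x; apply/oleNlt => fx.
have [y fy ymin] := @olt_min a [set y | olt (f y) y] x fx.
by move/oleNlt: (ymin (f y) (fm _ _ fy)); exact.
Qed.

Lemma initial_embedding_comp a b c (f : a -> b) (g : b -> c) :
  initial_embedding f -> initial_embedding g -> initial_embedding (g \o f).
Proof.
move=> [fm fi] [gm gi]; split=> [x y xy|x z zx]; first exact/gm/fm.
have [y yz] := gi _ _ zx; move: zx; rewrite -yz /= (olt_monoE gm) => /fi[x' <-].
by exists x'.
Qed.

Lemma iso_initial_embedding a b :
  ord_iso a b -> exists2 f : a -> b, initial_embedding f & forall y, exists x, f x = y.
Proof.
move=> [f [g fK gK] fm]; exists f; last by move=> y; exists (g y).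
by split=> [x y /fm//|x y _]; exists (g y).
Qed.

Lemma initial_embedding_iso a b (f : a -> b) :
  initial_embedding f -> (forall y, exists x, f x = y) -> ord_iso a b.
Proof.
move=> [fm _] fs; exists f; first exact: inj_surj_bij (olt_mono_inj fm) fs.
by move=> x y; rewrite (olt_monoE fm).
Qed.

Lemma ord_iso_sym a b : ord_iso a b -> ord_iso b a.
Proof.
move=> [f [g fK gK] fm]; exists g; first by exists f.
by move=> x y; rewrite -{1}(gK x) -{1}(gK y) fm.
Qed.

Lemma seg_initial_embedding a (x : a) :
  initial_embedding (fun z : ord_seg x => sval z : a).
Proof.
split=> // -[z zx] y /= yz; exact: (ex_intro _ (exist _ y (olt_trans yz zx))).
Qed.

Lemma ord_lt_initial_embedding a b : ord_lt a b ->
  exists2 f : a -> b, initial_embedding f & exists y, forall x, olt (f x) y.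
Proof.
move=> [y /iso_initial_embedding[f fi _]].
exists ((fun z : ord_seg y => sval z : b) \o f).
  exact: initial_embedding_comp fi (@seg_initial_embedding b y).
by exists y => x /=; exact: svalP (f x).
Qed.

Lemma ord_leP a b : ord_le a b <-> exists f : a -> b, initial_embedding f.
Proof.
split=> [[/ord_lt_initial_embedding|/iso_initial_embedding] [f fi _]|[f fi]];
  [by exists f|by exists f|].
have [fs|] := pselect (forall y, exists x, f x = y).
  by right; exact: initial_embedding_iso fs.
move=> /existsNP[y0 /forallNP y0f]; left.
have [y yf ymin] := @olt_min b (~` range f)
  y0 (fun '(ex_intro2 x _ e) => y0f x e).
have fy x : olt (f x) y.
  case: (olt_total (f x) y) => // [fxy|yx]; first by case: yf; exists x.
  by have [z zy] := fi.2 _ _ yx; case: yf; exists z.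
exists y; apply: (@initial_embedding_iso a (ord_seg y)
  (fun x => exist _ (f x) (fy x))).
  split=> [u v uv|x [z zy] /= zx]; first exact: fi.1.
  have [x' x'z] := fi.2 _ _ zx; exists x'; exact: eq_exist.
move=> [z zy]; have [[x _ xz]|nz] := pselect (range f z).
  by exists x; exact: eq_exist.
by case/oleNlt: (ymin _ nz).
Qed.

Lemma ord_le_inj a b : ord_le a b -> exists f : a -> b, injective f.
Proof. by move=> /ord_leP[f [/olt_mono_inj fi _]]; exists f. Qed.

(** Send each [x] in [a] to the least element of [b] missed below [x].  If
   this never gets stuck it embeds [a] as an initial segment of [b]; at the
   least [x] where it is stuck, the values below [x] fill [b], and their inverse
   embeds [b] into [a]. *)
Lemma ord_le_total a b : ord_le a b \/ ord_le b a.
Proof.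
have [[d _]|bE] := pselect (exists d : b, True); last first.
  right; apply/ord_leP; exists (fun y => False_rect a (bE (ex_intro _ y Logic.I))).
  by split=> x; case: (bE (ex_intro _ x Logic.I)).
pose fresh (x : a) (r : forall y, olt y x -> b) : set b :=
  [set y | (forall z (zx : olt z x), r z zx <> y) /\
           forall y', olt y' y -> exists z (zx : olt z x), r z zx = y'].
pose pick (A : set b) := if pselect (exists y, A y) is left e then sval (cid e) else d.
pose g := Fix (@olt_wf a) (fun _ => b) (fun x r => pick (fresh x r)).
have gE x : g x = pick (fresh x (fun z _ => g z)).
  rewrite {1}/g Fix_eq // => y r s rs; suff -> : r = s by [].
  by apply: functional_extensionality_dep => z; apply: funext => zy; exact: rs.
pose full x := forall y, exists2 z, olt z x & g z = y.
have gP x : ~ full x -> fresh x (fun z _ => g z) (g x).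
  move=> /existsNP[y ny]; rewrite gE /pick.
  case: pselect => [e|nf]; first exact: (svalP (cid e)).
  have [u uP umin] := @olt_min b [set u | forall z, olt z x -> g z <> u]
    y (fun z zx e => ny (ex_intro2 _ _ z zx e)).
  case: nf; exists u; split=> [//|y' y'u].
  apply: contrapT => ny'.
  suff h : forall z, olt z x -> g z <> y' by exact: ole_ltF (umin y' h) y'u.
  by move=> z zx zy'; apply: ny'; exists z, zx.
have gm x z : ~ full x -> ~ full z -> olt z x -> olt (g z) (g x).
  move=> /gP[xf _] /gP[_ zi] zx; case: (olt_total (g z) (g x)) => // [e|xz].
    by case: (xf _ zx).
  have [u [uz e]] := zi _ xz.
  by case: (xf u (olt_trans uz zx)).
have [[x xF]|nF] := pselect (exists x, full x).
  have [{xF}x xF xmin] := @olt_min a full x xF.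
  have nfull z : olt z x -> ~ full z by move=> zx zF; exact: ole_ltF (xmin z zF) zx.
  have /choice[f fP] : forall y, exists z, olt z x /\ g z = y.
    by move=> y; have [z] := xF y; exists z.
  right; apply/ord_leP; exists f; split=> [u v uv|u z zu].
    have [fux fue] := fP u; have [fvx fve] := fP v.
    case: (olt_total (f u) (f v)) => // [e|vu].
      by move: uv; rewrite -fue -fve e => /olt_irr.
    have := gm _ _ (nfull _ fux) (nfull _ fvx) vu.
    by rewrite fue fve => /(olt_asym uv).
  exists (g z); have [fzx fze] := fP (g z).
  have zx : olt z x by apply: olt_trans zu _; case: (fP u).
  case: (olt_total (f (g z)) z) => // h.
    by have := gm _ _ (nfull _ zx) (nfull _ fzx) h; rewrite fze => /olt_irr.
  by have := gm _ _ (nfull _ fzx) (nfull _ zx) h; rewrite fze => /olt_irr.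
left; apply/ord_leP; exists g.
have nfull x : ~ full x by move=> xF; apply: nF; exists x.
split=> [x y xy|x y yx]; first exact: gm.
by have [_ /(_ _ yx)[z [_ e]]] := gP _ (nfull x); exists z.
Qed.

Lemma ord_leNgt a b : ~ ord_le a b -> ord_lt b a.
Proof.
move=> nab; case: (ord_le_total a b) => // -[//|/ord_iso_sym ab].
by case: nab; right.
Qed.

(** The least initial segment of [a] (or [a] itself) that does not inject into
   [c] would be a cardinal greater than [c], hence at least [cplus], although it
   embeds into [a]. *)
Lemma lt_succ_cardinal_inj c cplus a : is_succ_cardinal c cplus ->
  ord_lt a cplus -> exists f : a -> c, injective f.
Proof.
move=> [_ _ cplus_min] a_lt.
pose small (b : Ord) := exists f : b -> c, injective f.
apply: contrapT => na.
have [b [bm nb bmin]] : exists b : Ord, [/\ exists f : b -> a, initial_embedding f,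
    ~ small b & forall z : b, small (ord_seg z)].
  have [[y ny]|ns] := pselect (exists y : a, ~ small (ord_seg y)).
    have [{ny}y ny ymin] := @olt_min a [set y | ~ small (ord_seg y)] y ny.
    exists (ord_seg y); split=> //.
      by eexists; exact: seg_initial_embedding.
    move=> z; apply: contrapT => nz.
    case: (pselect (small (ord_seg (sval z)))) => [[f fi]|/ymin zy]; last first.
      exact: ole_ltF zy (svalP z).
    case: nz; exists (fun u : ord_seg z =>
      f (exist (fun w : a => olt w (sval z)) (sval (sval u)) (svalP u))).
    move=> u v /fi/(congr1 sval)/= uv.
    do 2! [apply: eq_sig_hprop; first by move=> ? ? ?; exact: Prop_irrelevance].
    exact: uv.
  exists a; split; [by exists id; split=> // x y _; exists y|exact: na|].
  by move=> z; apply: contrapT => nz; apply: ns; exists z.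
have b_card : is_cardinal b.
  move=> d [y dy] /card_esym/card_eqPle[bd _].
  apply: nb; have [f fi] := bmin y.
  have [g gi] := (card_le_injP _ _).1 bd.
  have [h [hm _] _] := iso_initial_embedding dy.
  exists (f \o h \o g); apply: inj_comp gi; apply: inj_comp => //.
  exact: olt_mono_inj hm.
have c_lt : ord_lt c b.
  by apply: ord_leNgt => /ord_le_inj[f fi]; apply: nb; exists f.
have /ord_leP[f fi] := cplus_min b b_card c_lt.
have [g gi] := bm; have [h hi [y hy]] := ord_lt_initial_embedding a_lt.
have [m _] := initial_embedding_comp (initial_embedding_comp fi gi) hi.
exact: ole_ltF (olt_mono_le m y) (hy _).
Qed.

Lemma limit_nomax (m : Ord) : is_limit m -> forall x : m, exists y, olt x y.
Proof.
move=> lm x; apply: contrapT => /forallNP xmax; apply: lm.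
(* With a maximum [x], [m] is the successor of the segment below [x]. *)
exists (ord_seg x); apply: ord_iso_sym.
apply: (@initial_embedding_iso (ord_succ (ord_seg x)) m
  (fun v => if v is Some y then sval y else x)).
  split=> [[u|] [v|] //= uv|[u|] y /= yu].
  - exact: (svalP u).
  - by exists (Some (exist _ y (olt_trans yu (svalP u)))).
  - by exists (Some (exist _ y yu)).
move=> y; case: (olt_total y x) => [yx|->|/xmax//].
  by exists (Some (exist _ y yx)).
by exists None.
Qed.

Lemma addn_embedding (m : Ord) n :
  exists2 i : m -> ord_addn m n, initial_embedding i & finite_set (~` range i).
Proof.
elim: n => [|n [i [im ii] fi]].
  exists id; first by split=> // x y _; exists y.
  suff -> : ~` range (@id m) = set0 by exact: finite_set0.
  by apply/seteqP; split=> // x [] ; exists x.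
exists (Some \o i); first split=> [x y /im//|x [y|//] /= /ii[w <-]].
  by exists w.
have : finite_set ([set None] `|` Some @` (~` range i)).
  by rewrite finite_setU; split; [exact: finite_set1|exact: finite_image].
apply: sub_finite_set => -[y|] yi; [right|by left].
by exists y => // -[x _ xy]; apply: yi; exists x; rewrite //= xy.
Qed.

Lemma is_lim_embedding (l m : Ord) : is_lim l m ->
  exists2 i : m -> l, initial_embedding i & finite_set (~` range i).
Proof.
move=> [_ [n /ord_iso_sym/iso_initial_embedding[f fi fs]]].
have [i ii fini] := addn_embedding m n.
exists (f \o i); first exact: initial_embedding_comp ii fi.
apply: sub_finite_set (finite_image f fini) => y yi.
have [x xy] := fs y; exists x => // -[w _ wx]; apply: yi.
by exists w; rewrite //= wx.
Qed.

End OrdBasics.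

(** * Cantor-Bendixson derivatives of scattered modifications *)

Section CbOrd.
Variable X : topologicalType.

Lemma cb_initial_embedding (a b : Ord) (f : a -> b) :
  initial_embedding f -> forall x, cb X (f x) = cb X x.
Proof.
move=> [fm fi] x; elim/(well_founded_ind (@olt_wf a)): x => x IH.
rewrite !cbE; apply/seteqP; split=> p H y yx.
  by rewrite -IH //; apply: H; exact: fm.
have [z zy] := fi _ _ yx; rewrite -zy IH; last by apply/(olt_monoE fm); rewrite zy.
by apply: H; apply/(olt_monoE fm); rewrite zy.
Qed.

Lemma cb_derivative_iso (a b : Ord) :
  ord_iso a b -> cb_derivative X a = cb_derivative X b.
Proof.
move=> /iso_initial_embedding[f fi fs]; apply/seteqP; split=> p H y _.
  by have [x <-] := fs y; rewrite (cb_initial_embedding fi); exact: H.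
by rewrite -(cb_initial_embedding fi); exact: H.
Qed.

End CbOrd.

Section Smod.
Variables (X : topologicalType) (a : Ord) (h : X -> a).
Let Y := scattered_modification h.

Lemma smod_basic_open x U : open U -> U x -> open (smod_basic h x U : set Y).
Proof.
move=> oU Ux; exists [set smod_basic h x U].
  by move=> _ ->; exists x, U.
by rewrite bigcup_set1.
Qed.

Lemma smod_nbhsP (x : Y) (V : set Y) :
  nbhs x V <-> exists U : set X, [/\ open U, U x & smod_basic h x U `<=` V].
Proof.
rewrite nbhsE; split=> [[W [[D DB <-] [B DB' Bx]] WV]|[U [oU Ux UV]]].
  have [y [U [oU Uy BE]]] := DB _ DB'.
  have [Ux xU] : U x /\ (forall w, U w -> olt (h w) (h x) -> B w).
    rewrite BE in Bx *; case: Bx => [->|[Ux xy]]; first by split=> // w; right.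
    by split=> // w Uw wx; right; split=> //; exact: olt_trans wx xy.
  exists U; split=> // w [->|[Uw wx]]; apply: WV; exists B => //.
  exact: xU.
by exists (smod_basic h x U) => //; split; [exact: smod_basic_open|left].
Qed.

Lemma smod_hausdorff : hausdorff_space X -> hausdorff_space Y.
Proof.
rewrite !open_hausdorff => HX x y /HX[[A B] /= [/set_mem Ax /set_mem By]].
move=> [oA oB /eqP AB].
have sub z (U : set X) : U z -> smod_basic h z U `<=` U by move=> Uz w [->//|[]].
exists (smod_basic h x A, smod_basic h y B) => /=.
  by split; apply/mem_set; left.
split; [exact: smod_basic_open|exact: smod_basic_open|].
apply/eqP/seteqP; split=> // w [/(sub _ _ Ax) Aw /(sub _ _ By) Bw].
by rewrite -AB.
Qed.

Lemma smod_first_countable : first_countable X -> first_countable Y.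
Proof.
move=> HX x; have [B [cB Bx BP]] := HX x.
exists [set smod_basic h x V^° | V in B]; split.
- exact: sub_countable (card_image_le _ _) cB.
- move=> _ [V BV <-]; apply/smod_nbhsP; exists V^°; split=> //.
    exact: open_interior.
  exact: Bx.
- move=> W /smod_nbhsP[U [oU Ux UW]].
  have [V BV VU] := BP U (open_nbhs_nbhs (conj oU Ux)).
  exists (smod_basic h x V^°); first by exists V.
  move=> w [->|[Vw wx]]; apply: UW; first by left.
  by right; split=> //; apply: VU; exact: interior_subset Vw.
Qed.

Lemma smod_scattered : scattered Y.
Proof.
move=> A [p Ap].
have [_ [x Ax <-] xmin] := @olt_min a [set h x | x in A] (h p) (imageP h Ap).
exists x; split; first exact: mem_set.
exists (smod_basic h x setT); first by apply/smod_nbhsP; exists setT; split=> //; exact: openT.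
apply/seteqP; split=> [y [[//|[_ yx]] Ay]|_ ->]; last by split=> //; left.
by case: (ole_ltF (xmin _ (imageP h Ay)) yx).
Qed.

Hypothesis hh : height_function h.

(** A basic neighbourhood of [x] contains no other point of height at least
   [h x], so the points of height [y] are isolated; density of the level [y]
   puts a point of that level into every neighbourhood of a higher point. *)
Lemma isolated_height_ge (y : a) :
  isolated ([set x | ole y (h x)] : set Y) = h @^-1` [set y].
Proof.
apply/seteqP; split=> x.
  move=> [/set_mem /= yx [V /smod_nbhsP[U [oU Ux UV]] VE]].
  case: yx => [yx|->//].
  have [w [wy Uw]] := hh.2 _ _ (or_introl yx) U (open_nbhs_nbhs (conj oU Ux)).
  have : (V `&` [set x | ole y (h x)]) w.
    split; last by right; rewrite -wy.
    by apply: UV; right; split=> //; rewrite wy.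
  by rewrite VE => wx; rewrite /= -wx wy.
move=> /= xy; split; first by apply/mem_set; right; rewrite -xy.
exists (smod_basic h x setT); first by apply/smod_nbhsP; exists setT; split=> //; exact: openT.
apply/seteqP; split=> [w [[//|[_ wx]] yw]|_ ->].
  by move: wx; rewrite xy => /(ole_ltF yw).
by split; [left|right].
Qed.

Lemma derived_height_ge (y : a) :
  derived ([set x | ole y (h x)] : set Y) = [set x | olt y (h x)].
Proof.
rewrite /derived isolated_height_ge; apply/seteqP; split=> x /=.
  by move=> [[//|->]]; case.
by move=> yx; split; [left|move=> xy; move: yx; rewrite xy; exact: olt_irr].
Qed.

Lemma smod_cbE (y : a) : cb Y y = [set x | ole y (h x)].
Proof.
elim/(well_founded_ind (@olt_wf a)): y => y IH; rewrite cbE.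
apply/seteqP; split=> x /= H.
  apply/oleNlt => xy; have := H _ xy; rewrite IH // derived_height_ge.
  exact: olt_irr.
by move=> z zy; rewrite IH // derived_height_ge; exact: olt_le_trans zy H.
Qed.

Lemma smod_scattered_height : scattered_height Y a.
Proof.
split; first exact: smod_scattered.
  apply/seteqP; split=> // x H; have := H (h x) Logic.I.
  by rewrite smod_cbE derived_height_ge => /olt_irr.
move=> b b0; apply: contrapT => /ord_leNgt[y /cb_derivative_iso E].
have [x xy] := hh.1 y.
have : cb Y y x by rewrite smod_cbE /=; right.
by rewrite -cb_derivative_seg -E b0.
Qed.

(** The level [z] is dense in the original topology, and every basic
   neighbourhood of a point of positive height contains the points of height
   [z] of an open set. *)
Lemma smod_separable (z : a) : (forall y, ole z y) ->
  countable (h @^-1` [set z]) -> separable Y.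
Proof.
move=> zmin cz; exists (h @^-1` [set z]) => // O [x Ox] oO.
have /smod_nbhsP[U [oU Ux UO]] := open_nbhs_nbhs (conj oO Ox).
case: (zmin (h x)) => [zx|zx]; last by exists x; split=> //; rewrite /= -zx.
have [w [wz Uw]] := hh.2 z x (or_introl zx) U (open_nbhs_nbhs (conj oU Ux)).
by exists w; split=> //; apply: UO; right; split=> //; rewrite wz.
Qed.

Lemma smod_special (R : realType) : [set: X] !=set0 -> metrizable R X -> special R Y.
Proof.
move=> X0 mX; split; first exact: smod_scattered.
by exists X, a, h; split=> //; exists id, id; split=> // x.
Qed.

End Smod.

(** * Subspaces of the Cantor space *)

Definition agree (k : nat) (x y : nat -> bool) := forall j, (j < k)%N -> x j = y j.

Lemma agree_sym k x y : agree k x y -> agree k y x.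
Proof. by move=> xy j jk; rewrite xy. Qed.

Lemma agree_trans k x y z : agree k x y -> agree k y z -> agree k x z.
Proof. by move=> xy yz j jk; rewrite xy // yz. Qed.

Lemma agree_leq k k' x y : (k <= k')%N -> agree k' x y -> agree k x y.
Proof. by move=> kk' xy j jk; apply: xy; exact: leq_trans jk kk'. Qed.

Lemma agree_eq x y : (forall k, agree k x y) -> x = y.
Proof. by move=> xy; apply/funext => j; exact: (xy j.+1). Qed.

Lemma agree_mkseq k x y : mkseq x k = mkseq y k <-> agree k x y.
Proof.
split=> [xy j jk|xy].
  by have := congr1 (fun s => nth false s j) xy; rewrite !nth_mkseq.
by apply/eq_in_map => j; rewrite mem_iota add0n => /andP[_]; exact: xy.
Qed.

(** The parameter [R] is there to attach an [R]-valued metric to the type. *)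
Definition cantor_sub (R : realType) (P : set (nat -> bool)) : Type := {x | P x}.

Section CantorSubspace.
Variables (R : realType) (P : set (nat -> bool)).
Local Notation T := (cantor_sub R P).
Local Open Scope ring_scope.
Import Order.TTheory GRing.Theory Num.Theory.

Let diff (x y : T) := exists k, sval x k != sval y k.

(** The usual ultrametric: the distance of two points that first differ at [k]
   is [1 / (k + 1)]. *)
Definition cantor_dist (x y : T) : R :=
  if pselect (diff x y) is left e then (ex_minn e).+1%:R^-1 else 0.

Lemma cantor_dist_ge0 x y : 0 <= cantor_dist x y.
Proof. by rewrite /cantor_dist; case: pselect => // e; rewrite invr_ge0. Qed.

Lemma cantor_dist_ltP x y k :
  cantor_dist x y < k.+1%:R^-1 <-> agree k.+1 (sval x) (sval y).
Proof.
rewrite /cantor_dist; case: pselect => [e|nd].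
  case: ex_minnP => m dm mmin; rewrite ltf_pV2 ?posrE // ltr_nat ltnS.
  split=> [km j jk|xy].
    apply/eqP; apply: contraT => /mmin mj.
    by have := leq_trans jk (leq_trans km mj); rewrite ltnn.
  by rewrite ltnNge; apply/negP => mk; move/eqP: dm; apply; exact: xy.
split=> _; last by rewrite invr_gt0.
by move=> j _; apply/eqP; apply: contraT => dj; case: nd; exists j.
Qed.

Lemma cantor_dist_ge x y j :
  sval x j != sval y j -> j.+1%:R^-1 <= cantor_dist x y.
Proof.
move=> xyj; rewrite leNgt; apply/negP => /cantor_dist_ltP xy.
by rewrite xy ?eqxx in xyj.
Qed.

Lemma cantor_distxx x : cantor_dist x x = 0.
Proof. by rewrite /cantor_dist; case: pselect => // e; case: ex_minnP => m; rewrite eqxx. Qed.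

Lemma cantor_dist_eq0 x y : cantor_dist x y = 0 -> x = y.
Proof.
move=> xy0; apply: eq_sig_hprop => [z|]; first exact: Prop_irrelevance.
by apply: agree_eq => k; apply: (@agree_leq _ k.+1) => //;
  apply/cantor_dist_ltP; rewrite xy0 invr_gt0.
Qed.

Lemma cantor_dist_sym x y : cantor_dist x y = cantor_dist y x.
Proof.
suff h u v : cantor_dist u v <= cantor_dist v u by apply/eqP; rewrite eq_le !h.
rewrite {1}/cantor_dist; case: pselect => [e|_]; last exact: cantor_dist_ge0.
by case: ex_minnP => m dm _; apply: cantor_dist_ge; rewrite eq_sym.
Qed.

Lemma cantor_dist_triangle y x z :
  cantor_dist x z <= cantor_dist x y + cantor_dist y z.
Proof.
rewrite {1}/cantor_dist; case: pselect => [e|_]; last first.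
  by rewrite addr_ge0 ?cantor_dist_ge0.
case: ex_minnP => m dm _; have [xym|xym] := eqVneq (sval x m) (sval y m).
  rewrite -[leLHS]add0r lerD ?cantor_dist_ge0 //; apply: cantor_dist_ge.
  by rewrite -xym.
rewrite -[leLHS]addr0 lerD ?cantor_dist_ge0 //; exact: cantor_dist_ge.
Qed.

HB.instance Definition _ := gen_eqMixin T.
HB.instance Definition _ := gen_choiceMixin T.
HB.instance Definition _ := isMetric.Build R T cantor_distxx cantor_dist_eq0
  cantor_dist_sym cantor_dist_triangle.

Lemma cantor_sub_nbhsP (x : T) (V : set T) :
  nbhs x V <-> exists k, forall y : T, agree k (sval x) (sval y) -> V y.
Proof.
split=> [/nbhs_ballP[e /= e0 eV]|[k kV]].
  have [k ke] : exists k, k.+1%:R^-1 < e.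
    exists (Num.truncn e^-1); rewrite invf_plt ?posrE //.
    exact: truncnS_gt.
  exists k.+1 => y /cantor_dist_ltP xy; apply: eV.
  by rewrite ballEmdist; exact: lt_trans xy ke.
apply/nbhs_ballP; exists k.+1%:R^-1 => /=; first by rewrite invr_gt0.
move=> y; rewrite ballEmdist => /cantor_dist_ltP xy; apply: kV.
exact: agree_leq xy.
Qed.

Lemma cantor_sub_openP (U : set T) : open U <->
  forall x : T, U x -> exists k, forall y : T, agree k (sval x) (sval y) -> U y.
Proof.
rewrite openE; split=> [oU x Ux|H x Ux]; first exact/cantor_sub_nbhsP/oU.
exact/cantor_sub_nbhsP/H.
Qed.

Lemma cantor_sub_first_countable : first_countable T.
Proof.
move=> x; exists (range (fun k => [set y : T | agree k (sval x) (sval y)])).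
split.
- exact: sub_countable (card_image_le _ _) (countableP _).
- by move=> _ [k _ <-]; apply/cantor_sub_nbhsP; exists k.
- move=> U /cantor_sub_nbhsP[k kU]; exists [set y : T | agree k (sval x) (sval y)] => //.
Qed.

Lemma cantor_sub_metrizable : metrizable R T.
Proof. by exists T, id, id; split=> // x. Qed.

Lemma cantor_sub_hausdorff : hausdorff_space T.
Proof. exact: metric_hausdorff. Qed.

End CantorSubspace.

(** * Uncountable closed subsets of the Cantor space *)

(** Closedness in the product topology, in terms of prefixes. *)
Definition cclosed (C : set (nat -> bool)) :=
  forall x, (forall k, exists2 y, C y & agree k x y) -> C x.

Lemma uncountable_cantor : ~ countable [set: nat -> bool].
Proof.
move=> /countable_injP[f finj].
pose d (n : nat) : bool := ~~ `[< exists2 g : nat -> bool, f g = n & g n >].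
have : d (f d) = ~~ d (f d).
  rewrite {1}/d; congr (~~ _); apply/asboolP/idP => [[g gd gfd]|dd].
    by move: gfd; rewrite (finj g d (in_setT _) (in_setT _) gd).
  by exists d.
by case: (d (f d)).
Qed.

Lemma inj_uncountable (A : set (nat -> bool)) (f : (nat -> bool) -> nat -> bool) :
  injective f -> (forall x, A (f x)) -> ~ countable A.
Proof.
move=> finj fA /countable_injP[g ginj]; apply: uncountable_cantor.
apply/countable_injP; exists (g \o f) => x y _ _ /ginj.
by move=> /(_ (mem_set (fA x)) (mem_set (fA y)))/finj.
Qed.

Section PerfectSet.
Variable C : set (nat -> bool).
Hypotheses (Ccl : cclosed C) (Cunc : ~ countable C).

Definition branch (s : seq bool) := C `&` [set x | mkseq x (size s) = s].
Definition fat (s : seq bool) := ~ countable (branch s).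

Lemma branch_mkseq k x : C x -> branch (mkseq x k) x.
Proof. by move=> Cx; split=> //=; rewrite size_mkseq. Qed.

(** There are countably many cylinders, so the points of [C] lying in some
   countable branch form a countable set.  Hence a fat branch has two distinct
   points all of whose prefixes are fat; cut both after their first difference. *)
Lemma fat_split s : fat s -> exists s0 s1 : seq bool,
  [/\ fat s0 /\ fat s1, (size s < size s0)%N, size s1 = size s0, s1 <> s0 &
      take (size s) s0 = s /\ take (size s) s1 = s].
Proof.
move=> fs; pose kern := branch s `&` [set x | forall k, fat (mkseq x k)].
have [x [[[Cx xs] fx] [y [[[Cy ys] fy] xy]]]] :
    exists x, kern x /\ exists y, kern y /\ x <> y.
  apply: contrapT => nxy; apply: fs.
  have lean : countable (\bigcup_(t in [set t | countable (branch t)]) branch t).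
    by apply: bigcup_countable => //; exact: countableP.
  have ker1 : countable kern.
    have [[x kx]|nk] := pselect (kern !=set0); last first.
      by have -> : kern = set0 by apply/seteqP; split=> // x kx; case: nk; exists x.
    apply: sub_countable (countable1 x); apply: subset_card_le => y ky /=.
    by apply: contrapT => yx; apply: nxy; exists y; split=> //; exists x.
  apply: sub_countable (countable_setU ker1 lean); apply: subset_card_le => x bx.
  have [fx|] := pselect (forall k, fat (mkseq x k)); first by left.
  move=> /existsNP[k /contrapT nk]; right; exists (mkseq x k) => //.
  by apply: branch_mkseq; case: bx.
have [j xyj] : exists j, x j <> y j.
  by apply: contrapT => /forallNP H; apply: xy; apply/funext => j; apply: contrapT; exact: H.
have tk z : mkseq z (size s) = s -> take (size s) (mkseq z (maxn (size s) j).+1) = s.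
  move=> zs; rewrite -[RHS]zs /mkseq -map_take take_iota; congr (map _ (iota _ _)).
  by apply/minn_idPl; rewrite ltnW // ltnS leq_maxl.
exists (mkseq x (maxn (size s) j).+1), (mkseq y (maxn (size s) j).+1).
rewrite !size_mkseq; split=> //; [by rewrite ltnS leq_maxl| |by split; exact: tk].
by move/agree_mkseq/(_ j); rewrite ltnS leq_maxr => /(_ isT)/esym.
Qed.

(** The perfect set theorem: iterating [fat_split] embeds the full binary tree
   into the tree of fat prefixes, and [C] contains its branches. *)
Lemma uncountable_closed_inj :
  exists2 f : (nat -> bool) -> nat -> bool, injective f & forall x, C (f x).
Proof.
have fat0 : fat [::].
  move=> h; apply: Cunc; apply: sub_countable h; apply: subset_card_le => x Cx.
  by split.
have /choice[F FP] : forall s, exists p : seq bool * seq bool, fat s ->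
    [/\ fat p.1 /\ fat p.2, (size s < size p.1)%N, size p.2 = size p.1, p.2 <> p.1 &
        take (size s) p.1 = s /\ take (size s) p.2 = s].
  move=> s; have [/fat_split[s0 [s1 []]]|] := pselect (fat s).
    by exists (s0, s1).
  by exists ([::], [::]).
pose T := fix T (x : nat -> bool) n := if n is m.+1
  then (if x m then (F (T x m)).2 else (F (T x m)).1) else [::].
have Tfat x n : fat (T x n).
  by elim: n => //= n /FP[[? ?] _ _ _ _]; case: ifP.
have Tsize x n : (n <= size (T x n))%N.
  elim: n => //= n IH; have [_ h e _ _] := FP _ (Tfat x n).
  by case: ifP => _; rewrite ?e; exact: leq_ltn_trans h.
have Ttake x n m : (n <= m)%N -> take (size (T x n)) (T x m) = T x n /\
    (size (T x n) <= size (T x m))%N.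
  elim: m => [|m IH]; first by rewrite leqn0 => /eqP ->; rewrite take_size.
  rewrite leq_eqVlt => /orP[/eqP ->|]; first by rewrite take_size.
  rewrite ltnS => /IH[tk sz]; have [_ h e _ [t0 t1]] := FP _ (Tfat x m).
  have szS : (size (T x m) < size (T x m.+1))%N by move=> /=; case: ifP; rewrite ?e.
  split; last exact: leq_trans sz (ltnW szS).
  rewrite -[RHS]tk -[in RHS](_ : take (size (T x m)) (T x m.+1) = T x m).
    by rewrite take_takel.
  by move=> /=; case: ifP.
pose g x j := nth false (T x j.+1) j.
have gT x n : mkseq (g x) (size (T x n)) = T x n.
  apply: (@eq_from_nth _ false); rewrite size_mkseq // => j jn.
  rewrite nth_mkseq // /g; case: (leqP n j.+1) => [/Ttake -/(_ x)[<- _]|/ltnW].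
    by rewrite nth_take.
  move=> /Ttake -/(_ x)[<- _]; rewrite nth_take //; exact: Tsize.
exists g.
  move=> x y gxy; suff h n : T x n = T y n /\ agree n x y.
    by apply: agree_eq => k; case: (h k).
  elim: n => [|n [Txy xy]]; first by split.
  have [_ _ e ne _] := FP _ (Tfat x n).
  suff xyn : x n = y n.
    split; first by rewrite /= Txy xyn.
    by move=> j; rewrite ltnS leq_eqVlt => /orP[/eqP -> //|]; exact: xy.
  have sz : size (T x n.+1) = size (T y n.+1).
    by move=> /=; rewrite -Txy; do 2 case: ifP => _ //; rewrite e.
  have : T x n.+1 = T y n.+1 by rewrite -(gT x) -(gT y) gxy sz.
  by move=> /=; rewrite -Txy; case: (x n) (y n) => -[] // h; case: ne.
move=> x; apply: Ccl => k.
have [y [Cy /= yT]] : branch (T x k) !=set0.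
  apply: contrapT => n0; apply: (Tfat x k); suff -> : branch (T x k) = set0 by [].
  by apply/seteqP; split=> // y Cy; apply: n0; exists y.
exists y => //; apply: agree_leq (Tsize x k) _; apply/agree_mkseq.
by rewrite yT gT.
Qed.

End PerfectSet.

Lemma cantor_prod_inj :
  exists f : (nat -> bool) * (nat -> bool) -> nat -> bool, injective f.
Proof.
exists (fun p i => (if odd i then p.1 else p.2) i./2) => -[x y] [x' y'] /= E.
congr (_, _); apply/funext => j.
  by have := congr1 (fun f => f j.*2.+1) E; rewrite /= odd_double /= uphalf_double.
by have := congr1 (fun f => f j.*2) E; rewrite /= odd_double /= doubleK.
Qed.

Section Continuum.
Variable c : Ord.
Hypothesis hc : is_card [set: set nat] c.

Lemma continuum_inj : (exists f : (nat -> bool) -> c, injective f) /\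
  (exists f : c -> nat -> bool, injective f).
Proof.
have /card_eqPle[cs sc] := hc.2; split.
  have [f fi] := (card_le_injP _ _).1 sc.
  exists (fun x => f [set n | x n]) => x y /fi E; apply/funext => n.
  by apply/idP/idP; have := congr1 (fun A : set nat => A n) E => /= ->.
have [f fi] := (card_le_injP _ _).1 cs.
exists (fun x n => `[< f x n >]) => x y E; apply: fi; apply/funext => n.
apply: propext; apply: asbool_eq_equiv; exact: (congr1 (fun A => A n) E).
Qed.

(** A Bernstein decomposition.  The triples (closed set, index [i] in [I],
   label [r]) are enumerated along [c], and a new point [x p] of the closed set is
   chosen for the [p]-th triple.  This is possible since an uncountable closed
   set has continuum many points, and fewer have been used before [p].  The
   point gets the index [i], and varying the label [r] makes the fibres
   uncountable on every uncountable closed set. *)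
Lemma bernstein (I : Type) (i0 : I) (u : I -> c) : injective u ->
  exists b : (nat -> bool) -> I, forall C, cclosed C -> ~ countable C ->
    forall i, ~ countable (C `&` b @^-1` [set i]).
Proof.
move=> ui; have [[f fi] [g gi]] := continuum_inj.
have [pr pri] := cantor_prod_inj.
pose code (t : (nat -> bool) * I * (nat -> bool)) : c :=
  f (pr (t.1.1, pr (g (u t.1.2), t.2))).
have codei : injective code.
  by move=> [[x i] r] [[x' i'] r'] /fi/pri[-> /pri[/gi/ui -> ->]].
have [dec codeK] := inj_retraction (xpred0, i0, xpred0) codei.
(* Every set of words is the code of a closed set, so no triple is wasted on
   the question whether a code is valid. *)
pose C (p : c) : set (nat -> bool) :=
  [set x | forall k, (dec p).1.1 (choice.pickle (mkseq x k))].
have Ccl p : cclosed (C p).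
  move=> x H k; have [y Cy xy] := H k.
  by rewrite ((agree_mkseq k x y).2 xy); exact: Cy.
pose avail p (r : forall q, olt q p -> nat -> bool) : set (nat -> bool) :=
  C p `&` [set x | forall q (qp : olt q p), r q qp <> x].
pose pick (A : set (nat -> bool)) :=
  if pselect (exists y, A y) is left e then sval (cid e) else xpred0.
pose x := Fix (@olt_wf c) (fun _ => nat -> bool) (fun p r => pick (avail p r)).
have xE p : x p = pick (avail p (fun q _ => x q)).
  rewrite {1}/x Fix_eq // => q r s rs; suff -> : r = s by [].
  by apply: functional_extensionality_dep => z; apply: funext => zq; exact: rs.
have xP p : ~ countable (C p) -> avail p (fun q _ => x q) (x p).
  move=> Cunc; rewrite xE /pick; case: pselect => [e|ne]; first exact: (svalP (cid e)).
  have [h hi hC] := uncountable_closed_inj (Ccl p) Cunc.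
  have /choice[q qP] : forall y, exists q : ord_seg p, x (sval q) = h y.
    move=> y; apply: contrapT => nq; apply: ne; exists (h y); split=> // q qp e.
    by apply: nq; exists (exist _ q qp).
  have qi : injective q by move=> y y' e; apply: hi; rewrite -!qP e.
  (* Otherwise the continuum would inject into a proper segment of [c]. *)
  exfalso; apply: (hc.1 (ord_seg p)).
    by exists p; apply: (initial_embedding_iso (f := id)) => [|y];
      [split=> // ? y; exists y|exists y].
  apply/card_eqPle; split; apply/card_le_injP.
    exists sval => z z' e; apply: eq_sig_hprop => // ?; exact: Prop_irrelevance.
  by exists (q \o g); exact: inj_comp.
have xi p q : ~ countable (C p) -> ~ countable (C q) -> x p = x q -> p = q.
  move=> /xP[_ px] /xP[_ qx] e; case: (olt_total p q) => // [/qx|/px] //.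
  by move=> H; case: H.
pose b y := if pselect (exists p, ~ countable (C p) /\ x p = y) is left e
  then (dec (sval (cid e))).1.2 else i0.
have bE p : ~ countable (C p) -> b (x p) = (dec p).1.2.
  move=> Cp; rewrite /b; case: pselect => [e|]; last by case; exists p.
  by case: cid => q /= [Cq /(xi _ _ Cq Cp) ->].
exists b => A Acl Aunc i.
pose cA n := `[< exists2 y, A y & exists k, n = choice.pickle (mkseq y k) >].
pose p r := code (cA, i, r).
have CpE r : C (p r) = A.
  rewrite /C /p codeK /=; apply/seteqP; split=> y Ay; last first.
    by move=> k; apply/asboolP; exists y => //; exists k.
  apply: Acl => k; have /asboolP[z Az [k' e]] := Ay k; exists z => //.
  have {}e := pcan_inj choice.pickleK e.
  have kk' : k = k' by have := congr1 size e; rewrite !size_mkseq.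
  by apply/agree_mkseq; rewrite e kk'.
have Cpu r : ~ countable (C (p r)) by rewrite CpE.
apply: (@inj_uncountable _ (x \o p)) => [r r' /(xi _ _ (Cpu r) (Cpu r'))/codei[]//|r].
split; first by rewrite -(CpE r); case: (xP _ (Cpu r)).
by rewrite /= bE // codeK.
Qed.

End Continuum.

(** * Fibres of the trace, and K-Lusin families of traces *)

(** Two coordinates of [x] are spent on each bit of [trace x], so that a point
   of the Cantor space is a subset of [nat] together with, for each of its
   elements, one of three nonzero pairs: the fibres over infinite sets contain
   copies of the Cantor space. *)
Definition trace (x : nat -> bool) : nat -> bool := fun j => x j.*2 || x j.*2.+1.

Definition unbounded (a : nat -> bool) := forall k, exists j, (k <= j)%N /\ a j.

Lemma agree_trace k x y : agree k.*2 x y -> agree k (trace x) (trace y).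
Proof.
move=> xy j jk; rewrite /trace !xy //.
  by rewrite ltn_Sdouble.
by rewrite ltn_double.
Qed.

Lemma fiber_closed a w k : cclosed [set x | trace x = a /\ agree k w x].
Proof.
move=> x H; split.
  apply/funext => j; have [y [<- _] xy] := H j.+1.*2.
  exact: (agree_trace xy).
by have [y [_ wy] xy] := H k; exact: agree_trans wy (agree_sym xy).
Qed.

(** With [e] an enumeration of elements of [trace w] beyond [k], a sequence [t]
   is coded by putting the pair (true, false) or (false, true) at [e i], according to
   [t i]. *)
Lemma fiber_uncountable w k : unbounded (trace w) ->
  ~ countable [set x | trace x = trace w /\ agree k w x].
Proof.
move=> /choice[nx nxP].
pose e := fix e i := nx (if i is i'.+1 then (e i').+1 else k).
have e_lt i i' : (i < i')%N -> (e i < e i')%N.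
  apply: (@homo_ltn _ e (fun m n => m < n)%N); first exact: ltn_trans.
  by move=> n; case: (nxP (e n).+1).
have e_ge i : (k <= e i)%N.
  by elim: i => [|i IH]; [case: (nxP k)|exact: leq_trans IH (ltnW (e_lt _ _ (ltnSn i)))].
have e_tr i : trace w (e i) by case: i => [|i]; [case: (nxP k)|case: (nxP (e i).+1)].
have ei : injective e.
  move=> i i' ii'; case: (ltngtP i i') => // /e_lt; rewrite ii' ltnn //.
have [r er] := inj_retraction 0 ei.
pose g (t : nat -> bool) i :=
  if (i./2 < k)%N then w i else trace w i./2 && (t (r i./2) == odd i).
have gi : injective g.
  move=> t t' E; apply/funext => i.
  have := congr1 (fun f => f (e i).*2.+1) E.
  rewrite /g /= uphalf_double ltnNge e_ge /= e_tr er odd_double /=.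
  by case: (t i) (t' i) => -[].
apply: (@inj_uncountable _ g) => // t; split=> [|j jk]; last first.
  by rewrite /g (leq_ltn_trans _ jk) // -{2}(odd_double_half j) -addnn addnA leq_addl.
apply/funext => j; rewrite {1}/trace /g doubleK /= uphalf_double odd_double /=.
by case: ifP => // _; case: (trace w j) (t (r j)) => -[].
Qed.

(** A form of relative compactness of the sequence enumerating [a]: it is
   dominated by a function that depends on [F] and [m] only. *)
Definition hits (F : nat -> nat) (m : nat) (a : nat -> bool) :=
  forall k, (m <= k)%N -> exists j, [/\ (k <= j)%N, (j <= F k)%N & a j].

(** A point outside the given neighbourhoods of all finitely supported points
   has, for each [k], a true coordinate from [2 k] on and below the radius of the
   neighbourhood of its prefix of length [2 k] followed by zeros.  There are
   finitely many such prefixes. *)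
Lemma word_nbhs_hits (N : (nat -> bool) -> nat) : exists F, forall x,
  (forall s : seq bool, ~ agree (N (nth false s)) (nth false s) x) ->
  hits F 0 (trace x).
Proof.
exists (fun k => \max_(t : k.*2.-tuple bool) N (nth false t)) => x xN k _.
have st : size (mkseq x k.*2) == k.*2 by rewrite size_mkseq.
have /existsNP[i /not_implyP[iN xi]] := xN (mkseq x k.*2).
have ki : (k.*2 <= i)%N.
  by rewrite leqNgt; apply/negP => ik; apply: xi; rewrite nth_mkseq.
have {}xi : x i.
  by move: xi; rewrite nth_default ?size_mkseq //; case: (x i).
exists i./2; split.
- by rewrite -(doubleK k) half_leq.
- apply: leq_trans (leq_bigmax (Tuple st)) => /=; apply: leq_trans (ltnW iN).
  by rewrite -{2}(odd_double_half i) -addnn addnA leq_addl.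
- rewrite /trace; move: xi; rewrite -{1}(odd_double_half i).
  by case: (odd i) => /= ->; rewrite ?orbT.
Qed.

Fixpoint psum (l : nat -> nat) i := if i is i'.+1 then (psum l i' + (l i).+1)%N else l 0.

(** Points of the Baire space are coded by infinite subsets of [nat]. *)
Definition sums (l : nat -> nat) : nat -> bool := fun j => `[< exists i, psum l i = j >].

Lemma psum_lt l i i' : (i < i')%N -> (psum l i < psum l i')%N.
Proof.
apply: (@homo_ltn _ (psum l) (fun m n => m < n)%N); first exact: ltn_trans.
by move=> n /=; rewrite addnS ltnS leq_addr.
Qed.

Lemma psum_ge l i : (l i <= psum l i)%N.
Proof. by case: i => //= i; rewrite addnS ltnW // ltnS leq_addl. Qed.

Lemma psum_gei l i : (i <= psum l i)%N.
Proof. by elim: i => // i IH; exact: leq_ltn_trans IH (psum_lt l (ltnSn i)). Qed.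

Lemma sums_unbounded l : unbounded (sums l).
Proof.
move=> k; exists (psum l k); split; first exact: psum_gei.
by apply/asboolP; exists k.
Qed.

(** The partial sum after the [i]-th is at most [F k], for [k] the maximum of [m]
   and the successor of the [i]-th; [B] takes the maximum of these bounds over
   all values that the [i]-th partial sum may have. *)
Lemma hits_psum_bound F m : exists B : nat -> nat, forall l,
  hits F m (sums l) -> forall i, (psum l i <= B i)%N.
Proof.
pose B := fix B i := if i is i'.+1
  then \max_(k < (maxn m (B i').+1).+1) F k else F m.
exists B => l lF; elim=> [|i IH].
  have [j [_ jF /asboolP[i ij]]] := lF m (leqnn m); apply: leq_trans jF.
  by rewrite -ij; case: i {ij} => // i; apply: ltnW; exact: (psum_lt l (ltn0Sn i)).
have [j [kj jF /asboolP[i' ij]]] := lF (maxn m (psum l i).+1) (leq_maxl _ _).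
have ii' : (i < i')%N.
  rewrite ltnNge; apply/negP => i'i.
  have : (psum l i' <= psum l i)%N.
    by move: i'i; rewrite leq_eqVlt => /orP[/eqP ->//|/(psum_lt l)/ltnW].
  by rewrite ij leqNgt (leq_trans _ kj) // leq_maxr.
have le : (psum l i.+1 <= j)%N.
  rewrite -ij; move: ii'; rewrite leq_eqVlt => /orP[/eqP <-//|/(psum_lt l)/ltnW//].
have kb : (maxn m (psum l i).+1 < (maxn m (B i).+1).+1)%N.
  by rewrite ltnS geq_max leq_maxl /= leq_max ltnS IH orbT.
apply: leq_trans le (leq_trans jF _).
exact: (leq_bigmax (F := fun k : 'I_ _ => F k) (Ordinal kb)).
Qed.

Lemma compact_box (B : nat -> nat) :
  compact ([set l | forall i, (l i <= B i)%N] : set {ptws nat -> nat}).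
Proof.
apply: (@tychonoff _ (fun=> nat) (fun i => [set n | (n <= B i)%N])) => i.
apply: finite_compact; apply: sub_finite_set (finite_II (B i).+1).
by move=> n /=; rewrite ltnS.
Qed.

Lemma K_Lusin_hits_countable (L : set {ptws nat -> nat}) F m : K_Lusin L ->
  countable (L `&` [set l | hits F m (sums l)]).
Proof.
move=> KL; have [B BP] := hits_psum_bound F m.
apply: sub_countable (KL _ (@compact_box B)); apply: subset_card_le => l [Ll lF].
by split=> // i; exact: leq_trans (psum_ge l i) (BP _ lF i).
Qed.

Definition tail_eq (a a' : nat -> bool) := exists m, forall j, (m <= j)%N -> a j = a' j.

Definition overwrite (s : seq bool) (a : nat -> bool) : nat -> bool :=
  fun j => if (j < size s)%N then nth false s j else a j.

Lemma tail_eq_overwrite s a : tail_eq (overwrite s a) a.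
Proof. by exists (size s) => j; rewrite /overwrite ltnNge => ->. Qed.

Lemma overwriteE m a a' : (forall j, (m <= j)%N -> a j = a' j) -> a = overwrite (mkseq a m) a'.
Proof.
move=> aa'; apply/funext => j; rewrite /overwrite size_mkseq.
by case: ltnP => [jm|/aa'//]; rewrite nth_mkseq.
Qed.

Lemma overwrite_agree k w a : agree k w (overwrite (mkseq w k) a).
Proof. by move=> j jk; rewrite /overwrite size_mkseq jk nth_mkseq. Qed.

Lemma tail_eq_unbounded a a' : tail_eq a a' -> unbounded a' -> unbounded a.
Proof.
move=> [m mP] ua k; have [j [kj aj]] := ua (maxn m k); exists j.
by rewrite mP ?(leq_trans _ kj) ?leq_maxl ?leq_maxr.
Qed.

Lemma hits_leq F m m' a : (m <= m')%N -> hits F m a -> hits F m' a.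
Proof. by move=> mm' aF k m'k; apply: aF; exact: leq_trans mm' m'k. Qed.

Lemma hits_tail_eq F m a a' :
  (forall j, (m <= j)%N -> a j = a' j) -> hits F m a -> hits F m a'.
Proof.
move=> aa' aF k mk; have [j [kj jF aj]] := aF k mk; exists j.
by rewrite -aa' // (leq_trans mk).
Qed.

(** Closing the codes of [L] under finite changes keeps the K-Lusin property,
   and makes the tail class of every code dense. *)
Definition lusin_sums (L : set (nat -> nat)) :=
  [set a | exists2 l, L l & tail_eq a (sums l)].

Lemma lusin_sums_hits_countable (L : set {ptws nat -> nat}) F : K_Lusin L ->
  countable (lusin_sums L `&` [set a | hits F 0 a]).
Proof.
move=> KL.
pose G m := (L `&` [set l | hits F m (sums l)]).
have : countable (\bigcup_(p in [set: nat * seq bool])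
    ((fun l => overwrite p.2 (sums l)) @` G p.1)).
  apply: bigcup_countable => // p _.
  exact: sub_countable (card_image_le _ _) (K_Lusin_hits_countable _ _ KL).
apply: sub_countable; apply: subset_card_le => a [[l Ll [m al]] aF].
exists (m, mkseq a m) => //; exists l; last by rewrite /= -(overwriteE al).
split=> //=; apply: (hits_tail_eq al).
exact: hits_leq aF.
Qed.

Lemma lusin_sums_class_countable (L : set {ptws nat -> nat}) a : K_Lusin L ->
  unbounded a -> countable (L `&` [set l | tail_eq a (sums l)]).
Proof.
move=> KL /choice[F FP].
have : countable (\bigcup_m (L `&` [set l | hits F m (sums l)])).
  by apply: bigcup_countable => // m _; exact: K_Lusin_hits_countable.
apply: sub_countable; apply: subset_card_le => l [Ll [m al]]; exists m => //.
split=> //; apply: (hits_tail_eq al) => k mk.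
by have [kF aF] := FP k; exists (F k).
Qed.

Lemma tail_eq_countable a : countable [set x | tail_eq x a].
Proof.
have : countable (range (fun s => overwrite s a)).
  exact: sub_countable (card_image_le _ _) (countableP _).
apply: sub_countable; apply: subset_card_le => x [m xm].
by exists (mkseq x m) => //; rewrite -(overwriteE xm).
Qed.

(** * Ladder systems *)

(** [LL] is the index set of the fibres of the space to be built, and the fibre
   over [a] will have the heights below the ladder [S a], which is a sequence
   without maximum.  The second condition is the K-Lusin property, and the last one
   makes the points of each height in [J] dense. *)
Definition ladder_system (lam : Ord) (z : lam) (J : set lam)
    (LL : set (nat -> bool)) (S : (nat -> bool) -> nat -> lam) :=
  [/\ LL `<=` unbounded, forall F, countable (LL `&` [set a | hits F 0 a]),
      forall a n, LL a -> olt z (S a n) /\ J (S a n),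
      forall a n, LL a -> exists m, olt (S a n) (S a m) &
      forall y w k, J y -> exists a, [/\ LL a, agree k w a & exists n, olt y (S a n)]].

Section Ladders.
Variables (mu lam : Ord) (i : mu -> lam) (z : lam).
Hypotheses (i_emb : initial_embedding i) (z_min : forall y, ole z y).
Hypothesis mu_nomax : forall x : mu, exists y, olt x y.

(** One ladder, cofinal in [mu], serves for the countable dense set of all
   eventually true traces. *)
Lemma countable_cofinal_ladders (A : set mu) (x0 : mu) : countable A -> cofinal A ->
  exists LL S, ladder_system z (range i) LL S /\ countable LL.
Proof.
move=> cA cofA; have [y0 Ay0 _] := cofA x0.
have [f [fA fs]] := countable_enum Ay0 cA.
have [x1 x01] := mu_nomax x0.
have zx1 : olt z (i x1) by apply: ole_lt_trans (z_min _) (i_emb.1 _ _ x01).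
pose s n := i (if `[< olt z (i (f n)) >] then f n else x1).
have s_gt n : olt z (s n) by rewrite /s; case: asboolP.
have s_cof x : exists n, olt (i x) (s n).
  have [y xy] := mu_nomax x; have [v Av yv] := cofA y.
  have [n fn] := fs _ Av; exists n; have xv := olt_le_trans xy yv.
  rewrite /s fn asboolT; first exact: i_emb.1.
  exact: ole_lt_trans (z_min _) (i_emb.1 _ _ xv).
exists [set a | tail_eq a xpredT], (fun _ => s); split; last exact: tail_eq_countable.
split=> [a [m am] k|F|a n _|a n _|_ w k [x _ <-]].
- by exists (maxn m k); rewrite leq_maxr am ?leq_maxl.
- apply: sub_countable (tail_eq_countable xpredT).
  by apply: subset_card_le => a [].
- by split; [exact: s_gt|exists (if `[< olt z (i (f n)) >] then f n else x1)].
- exact: s_cof.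
- exists (overwrite (mkseq w k) xpredT); split.
  + exact: tail_eq_overwrite.
  + exact: overwrite_agree.
  + exact: s_cof.
Qed.

(** The cofinal set [A] is coded by elements of [L].  A tail class contains
   countably many of these codes, so the corresponding elements of [A] have an
   upper bound [B a] in [mu]; the ladder of [a] starts above [B a] and proceeds
   by iterating a choice [nx] of larger elements. *)
Lemma K_Lusin_ladders (L : set {ptws nat -> nat}) (A : set mu) :
  K_Lusin L -> A #<= L -> cofinal A ->
  (forall B : set mu, countable B -> ~ cofinal B) ->
  exists LL S, ladder_system z (range i) LL S.
Proof.
move=> KL /pcard_leP/injfunPex[e eL ei] cofA uncof.
have /choice[nx nxP] := mu_nomax.
have /choice[B BP] : forall a, exists x : mu, lusin_sums L a ->
    forall y, A y -> tail_eq a (sums (e y)) -> olt y x.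
  move=> a; have [La|nL] := pselect (lusin_sums L a); last first.
    have [x _] : [set: mu] !=set0.
      apply: contrapT => mu0; apply: (uncof set0) => // x; case: mu0; by exists x.
    by exists x.
  have ua : unbounded a.
    have [l _ al] := La; exact: tail_eq_unbounded al (sums_unbounded l).
  pose Ba := A `&` [set y | tail_eq a (sums (e y))].
  have cB : countable Ba.
    have /countable_injP[g gi] := lusin_sums_class_countable KL ua.
    apply/countable_injP; exists (g \o e) => x y /set_mem[Ax ax] /set_mem[Ay ay] exy.
    apply: ei; rewrite ?inE //; apply: gi exy; rewrite inE; split=> //; exact: eL.
  have /existsNP[x nx'] := uncof Ba cB; exists x => _ y Ay ay.
  case: (olt_total y x) => // [yx|xy]; case: nx'; exists y => //.
    by right.
  by left.
pose S a n := i (iter n.+1 nx (B a)).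
have S_gt a n : olt (i (B a)) (S a n).
  apply: i_emb.1; elim: n => [|n IH]; first exact: nxP.
  exact: olt_trans IH (nxP _).
exists (lusin_sums L), S; split=> [a [l _ al]|F|a n _|a n _|_ w k [x _ <-]].
- exact: tail_eq_unbounded al (sums_unbounded l).
- exact: lusin_sums_hits_countable.
- split; first exact: ole_lt_trans (z_min _) (S_gt a n).
  by exists (iter n.+1 nx (B a)).
- by exists n.+1; apply: i_emb.1; exact: nxP.
- have [y Ay xy] := cofA x.
  have La : lusin_sums L (overwrite (mkseq w k) (sums (e y))).
    by exists (e y); [exact: eL|exact: tail_eq_overwrite].
  exists (overwrite (mkseq w k) (sums (e y))); split=> //.
    exact: overwrite_agree.
  exists 0; apply: olt_trans (S_gt _ 0); apply: i_emb.1.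
  apply: ole_lt_trans xy _; apply: BP => //; exact: tail_eq_overwrite.
Qed.

End Ladders.

(** * The space *)

Section Construction.
Variables (R : realType) (c lam : Ord) (hc : is_card [set: set nat] c).
Variables (z : lam) (J : set lam).
Variables (LL : set (nat -> bool)) (S : (nat -> bool) -> nat -> lam).
Variable (tau : nat -> lam).
Hypotheses (z_min : forall y, ole z y) (Jz : J z).
Hypothesis J_down : forall x y, J y -> olt x y -> J x.
Hypothesis ladders : ladder_system z J LL S.
Hypothesis tau_top : forall n, ~ J (tau n) \/ countable LL /\ tau n = z.
Hypothesis tau_onto : forall t k, ~ J t -> exists n, (k <= n)%N /\ tau n = t.

Let LL_unbounded : LL `<=` unbounded. Proof. by case: ladders. Qed.

Let LL_hits F : countable (LL `&` [set a | hits F 0 a]). Proof. by case: ladders. Qed.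

Let S_gt0 a n : LL a -> olt z (S a n).
Proof. by case: ladders => _ _ SJ _ _ La; case: (SJ a n La). Qed.

Let S_nomax a n : LL a -> exists m, olt (S a n) (S a m).
Proof. by case: ladders => _ _ _ Sn _; exact: Sn. Qed.

Let S_cofinal y w k : J y ->
  exists a, [/\ LL a, agree k w a & exists n, olt y (S a n)].
Proof. by case: ladders => _ _ _ _ Sc; exact: Sc. Qed.

Let S_below a n t : LL a -> ~ J t -> olt (S a n) t.
Proof.
case: ladders => _ _ SJ _ _ La Jt; have [_ Jn] := SJ a n La.
by case: (olt_total (S a n) t) => // [e|/(J_down Jn)//]; case: Jt; rewrite -e.
Qed.

Let evfalse (x : nat -> bool) := tail_eq x xpred0.
Let evtrue (x : nat -> bool) := tail_eq x xpredT.
Let evconst : set (nat -> bool) := [set x | evfalse x \/ evtrue x].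
Let P : set (nat -> bool) := [set x | evconst x \/ LL (trace x)].
Let T := cantor_sub R P.

Let evconst_countable : countable evconst.
Proof.
apply: sub_countable (countable_setU (tail_eq_countable xpred0)
  (tail_eq_countable xpredT)).
by apply: subset_card_le => x [] ?; [left|right].
Qed.

Let countable_points (A : set (nat -> bool)) :
  countable A -> countable [set x : T | A (sval x)].
Proof.
move=> /countable_injP[f fi]; apply/countable_injP; exists (f \o sval).
move=> x y /set_mem Ax /set_mem Ay /(fi _ _ (mem_set Ax) (mem_set Ay)) xy.
by apply: eq_sig_hprop => // ?; exact: Prop_irrelevance.
Qed.

(** On the eventually false points each value is attained densely, which allows
   the countably many heights outside [J] to be spread over these points. *)
Let last_one (x : nat -> bool) : nat :=
  xget 0 [set n | x n /\ forall j, (n < j)%N -> x j = false].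

Let below (a : nat -> bool) (y : lam) := exists n, olt y (S a n).

Variable b : (nat -> bool) -> lam.
Hypothesis b_bernstein : forall C, cclosed C -> ~ countable C ->
  forall y, ~ countable (C `&` b @^-1` [set y]).

(** On a fibre, [b] is used as long as it stays below the ladder and avoids the
   countable level [z]; the other points are sent to a height that occurs anyway. *)
Let ht (x : nat -> bool) : lam :=
  if `[< evtrue x >] then z
  else if `[< evfalse x >] then tau (last_one x)
  else if `[< z <> b x /\ below (trace x) (b x) >] then b x
  else S (trace x) 0.

Let h (x : T) : lam := ht (sval x).

Let ht_fiber x : LL (trace x) -> ~ evconst x -> below (trace x) (ht x).
Proof.
move=> Lx nx; rewrite /ht; case: asboolP => [?|_]; first by case: nx; right.
case: asboolP => [?|_]; first by case: nx; left.
case: asboolP => [[]//|_]; exact: S_nomax.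
Qed.

Let ht_bernstein x : ~ evconst x -> z <> b x -> below (trace x) (b x) -> ht x = b x.
Proof.
move=> nx bz bb; rewrite /ht; case: asboolP => [?|_]; first by case: nx; right.
case: asboolP => [?|_]; first by case: nx; left.
by case: asboolP => // -[].
Qed.

Let level_meets a (C : set (nat -> bool)) y : LL a -> cclosed C -> ~ countable C ->
  (forall x, C x -> trace x = a) -> y <> z -> below a y ->
  exists x : T, [/\ C (sval x), trace (sval x) = a & h x = y].
Proof.
move=> La Ccl Cunc Ca yz ay; have nC := @b_bernstein C Ccl Cunc y.
have [x [[Cx bx] nx]] : exists x, (C `&` b @^-1` [set y]) x /\ ~ evconst x.
  apply: contrapT => /forallNP H; apply: nC; apply: sub_countable evconst_countable.
  by apply: subset_card_le => x Cx; apply: contrapT => nx; apply: (H x).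
have Px : P x by right; rewrite Ca.
exists (exist _ x Px); split=> //=; first exact: Ca.
by rewrite /h /= ht_bernstein ?bx // ?Ca // => zb; apply: yz; rewrite zb.
Qed.

Let below_dense (x : T) k y : LL (trace (sval x)) -> y <> z ->
  below (trace (sval x)) y ->
  exists x' : T, agree k (sval x) (sval x') /\ h x' = y.
Proof.
move=> Lx yz xy; have unc := @fiber_uncountable (sval x) k (@LL_unbounded _ Lx).
have [x' [[_ xx'] _ hx']] := level_meets Lx (@fiber_closed _ _ _) unc
  (fun _ => @proj1 _ _) yz xy.
by exists x'.
Qed.

(** A prefix of [w] can be continued with any trace that agrees with that of
   [w] so far: put [a j] into both coordinates of the pair [j]. *)
Let J_dense w k y : J y -> y <> z ->
  exists x : T, agree k w (sval x) /\ h x = y.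
Proof.
move=> Jy yz; have [a [La wa ay]] := @S_cofinal y (trace w) k Jy.
pose x i := if (i./2 < k)%N then w i else a i./2.
have tx : trace x = a.
  apply/funext => j; rewrite /trace /x doubleK /= uphalf_double.
  by case: ifP => [/wa <-//|_]; exact: orbb.
have wx : agree k w x.
  move=> j jk; rewrite /x (leq_ltn_trans _ jk) //.
  by rewrite -{2}(odd_double_half j) -addnn addnA leq_addl.
have Px : P x by right; rewrite tx.
have [|//||x' [xx' <-]] := @below_dense (exist _ x Px) k y; rewrite /= ?tx //.
by exists x'; split=> //; exact: agree_trans wx xx'.
Qed.

(** For [n] beyond [k] with [tau n = t], keep the prefix of [w] of length [k], and
   put the last true coordinate at [n]. *)
Let top_dense w k t : ~ J t -> exists x : T, agree k w (sval x) /\ h x = t.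
Proof.
move=> Jt; have [n [kn <-]] := @tau_onto t k Jt.
pose x := overwrite (mkseq w k) (eq_op^~ n).
have xn : x n by rewrite /x /overwrite size_mkseq ltnNge kn /= eqxx.
have xgt j : (n < j)%N -> x j = false.
  move=> nj; rewrite /x /overwrite size_mkseq ltnNge (leq_trans kn (ltnW nj)) /=.
  by rewrite gtn_eqF.
have xf : evfalse x by exists n.+1.
have Px : P x by left; left.
exists (exist _ x Px); split; first exact: overwrite_agree.
rewrite /h /ht /=; case: asboolP => [[m xm]|_].
  by have := xm (maxn m n.+1) (leq_maxl _ _); rewrite xgt // leq_maxr.
case: asboolP => // _; congr tau.
have [xl lx] : [set n | x n /\ forall j, (n < j)%N -> x j = false] (last_one x).
  by apply: xgetPex; exists n.
case: (ltngtP (last_one x) n) => //.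
  by move=> /lx; rewrite xn.
by move=> /xgt; rewrite xl.
Qed.

Let bot_dense w k : exists x : T, agree k w (sval x) /\ h x = z.
Proof.
pose x := overwrite (mkseq w k) xpredT.
have xt : evtrue x by exact: tail_eq_overwrite.
have Px : P x by left; right.
exists (exist _ x Px); split; first exact: overwrite_agree.
by rewrite /h /ht /=; case: asboolP.
Qed.

Let height_dense (x : T) k y : ole y (h x) ->
  exists x' : T, agree k (sval x) (sval x') /\ h x' = y.
Proof.
move=> yx; have [->|yz] := pselect (y = z); first exact: bot_dense.
have [Jy|] := pselect (J y); last exact: top_dense.
exact: J_dense.
Qed.

Let height_h : height_function h.
Proof.
split=> [y|y x yx U /cantor_sub_nbhsP[k kU]].
  have [Jy|Jy] := pselect (J y); last first.
    by have [x [_ <-]] := @top_dense xpred0 0 y Jy; exists x.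
  have [->|yz] := pselect (y = z).
    by have [x [_ <-]] := bot_dense xpred0 0; exists x.
  by have [x [_ <-]] := @J_dense xpred0 0 y Jy yz; exists x.
by have [x' [xx' hx']] := height_dense k yx; exists x'; split=> //; exact: kU.
Qed.

Let Y := scattered_modification h.

Let ht_z_evconst x : P x -> ht x = z -> evconst x.
Proof.
move=> [//|Lx] hz; apply: contrapT => nx.
have [n] := ht_fiber Lx nx; rewrite hz => zn.
move: hz; rewrite /ht; case: asboolP => [?|_]; first by case: nx; right.
case: asboolP => [?|_]; first by case: nx; left.
by case: asboolP => [[zb _]/esym//|_] e; move: (S_gt0 0 Lx); rewrite e => /olt_irr.
Qed.

(** Within the fibre over [a], the points [y] outside all given neighbourhoods
   of the points of height [S a n] form a closed set [W n].  This set misses the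
   height [S a n], so it is countable by the Bernstein property.  Every height in the
   fibre is below some [S a n], and countably many neighbourhoods suffice at each
   [n], since there are only countably many prefixes. *)
Let fiber_lindelof (N : T -> nat) a : LL a -> exists2 Z : set T, countable Z &
  countable [set y : T | trace (sval y) = a /\
    forall x, Z x -> ~ (agree (N x) (sval x) (sval y) /\ olt (h y) (h x))].
Proof.
move=> La; pose V n := [set x : T | trace (sval x) = a /\ h x = S a n].
pose W n := [set y | trace y = a /\ forall x, V n x -> ~ agree (N x) (sval x) y].
have Wcl n : cclosed (W n).
  move=> y H; split.
    suff [//] : [set x | trace x = a /\ agree 0 y x] y.
    by apply: fiber_closed => k; have [y' [y'a _] yy'] := H k; exists y'.
  move=> x Vx xy; have [y' [_ y'V] yy'] := H (N x).
  by apply: (y'V x Vx); exact: agree_trans xy yy'.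
have Wc n : countable (W n).
  apply: contrapT => Wunc.
  have [x [[_ Wx] xa hx]] := level_meets La (Wcl n) Wunc (fun _ => @proj1 _ _)
    (fun e => olt_irr (eq_ind _ (fun w => olt z w) (S_gt0 n La) _ e)) (S_nomax n La).
  by apply: (Wx x).
have /choice[rep repP] : forall p : nat * seq bool, exists x : option T,
    (exists2 x, V p.1 x & mkseq (sval x) (N x) = p.2) ->
    exists x', [/\ x = Some x', V p.1 x' & mkseq (sval x') (N x') = p.2].
  move=> p; have [[x Vx xp]|np] := pselect (exists2 x, V p.1 x & mkseq (sval x) (N x) = p.2).
    by exists (Some x) => _; exists x.
  by exists None.
exists [set x | exists p, rep p = Some x].
  have : countable (\bigcup_p [set x | rep p = Some x]).
    apply: bigcup_countable => // p _; case: (rep p) => [x|].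
      by apply: sub_countable (countable1 x); apply: subset_card_le => y [->].
    by apply: sub_countable (countable0 T); apply: subset_card_le => y.
  by apply: sub_countable; apply: subset_card_le => x [p px]; exists p.
have Wu : countable (\bigcup_n [set y : T | W n (sval y)]).
  by apply: bigcup_countable => // n _; exact: countable_points.
apply: sub_countable (countable_setU (countable_points evconst_countable) Wu).
apply: subset_card_le => y [ya yZ].
have [|ny] := pselect (evconst (sval y)); first by left.
right; have Ly : LL (trace (sval y)) by rewrite ya.
have [n yn] := ht_fiber Ly ny; rewrite ya in yn.
exists n => //; split=> // x Vx xy.
have [x' [rx [x'a hx'] e]] := repP (n, mkseq (sval x) (N x))
  (ex_intro2 _ _ x Vx erefl).
have eN : N x' = N x by have := congr1 size e; rewrite !size_mkseq.
apply: (yZ x'); first by exists (n, mkseq (sval x) (N x)).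
split; last by rewrite hx'.
rewrite eN; apply: agree_trans xy; apply/agree_mkseq.
by move: e => /= <-; rewrite eN.
Qed.

(** The neighbourhoods of the eventually constant points leave points in
   countably many fibres only: by the K-Lusin property if the eventually false
   points lie above all fibres, and trivially if there are countably many
   fibres.  Each of these fibres is handled by [fiber_lindelof]. *)
Let Y_lindelof : lindelof Y.
Proof.
move=> C Copen Ccov.
have /choice[nb nbP] : forall x : T, exists p : set T * nat,
    C p.1 /\ p.1 x /\ forall y : T, agree p.2 (sval x) (sval y) -> olt (h y) (h x) -> p.1 y.
  move=> x; have : setT x by [].
  rewrite -Ccov => -[U CU Ux].
  have /smod_nbhsP[V [oV Vx VU]] := open_nbhs_nbhs (conj (Copen _ CU) Ux).
  have [k kV] := (cantor_sub_openP V).1 oV x Vx.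
  exists (U, k); split=> //; split=> // y xy yx; apply: VU; right; split=> //.
  exact: kV.
pose N x := (nb x).2.
suff [Z Zc Zu] : exists2 Z : set T, countable Z & countable [set y : T |
    forall x, Z x -> ~ (agree (N x) (sval x) (sval y) /\ olt (h y) (h x))].
  set B := [set y : T | _] in Zu.
  exists ((fun x => (nb x).1) @` (Z `|` B)); split.
  - by move=> _ [x _ <-]; case: (nbP x).
  - apply: sub_countable (card_image_le _ _) _.
    exact: countable_setU.
  - apply/seteqP; split=> // y _.
    have [By|/existsNP[x /not_implyP[Zx /contrapT[xy yx]]]] := pselect (B y).
      exists (nb y).1; first by exists y => //; right.
      by have [_ []] := nbP y.
    exists (nb x).1; first by exists x => //; left.
    by have [_ [_]] := nbP x; apply.
pose Q := [set x : T | evconst (sval x)].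
have Qc : countable Q by exact: countable_points.
pose LL' := [set a | LL a /\ exists2 y : T, trace (sval y) = a /\ ~ evconst (sval y) &
  forall x, Q x -> ~ (agree (N x) (sval x) (sval y) /\ olt (h y) (h x))].
have LLc : countable LL'.
  have [Jall|nJ] := pselect (countable LL).
    by apply: sub_countable Jall; apply: subset_card_le => a [].
  have word_evfalse s : evfalse (nth false s) by exists (size s) => j; exact: nth_default.
  pose word (s : seq bool) : T :=
    exist P (nth false s) (or_introl (or_introl (word_evfalse s))).
  (* Only the radii at points of the form [nth false s] are tested, so 0 is a
     harmless default. *)
  have [F FP] := word_nbhs_hits (fun x =>
     if pselect (exists s, nth false s = x) is left e then N (word (sval (cid e))) else 0).
  apply: sub_countable (LL_hits F); apply: subset_card_le => a [La [y [ya ny] yQ]].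
  split=> //; rewrite /= -ya; apply: FP => s.
  case: pselect => [e|[]]; last by exists s.
  case: cid => s' /= <- sy; apply: (yQ (word s')); first by left; exact: word_evfalse.
  split=> //; have Ly : LL (trace (sval y)) by rewrite ya.
  have [n yn] := ht_fiber Ly ny; apply: olt_trans yn _; apply: S_below => //.
  rewrite /h /ht /=; case: asboolP => [[m mT]|_].
    have := mT (maxn m (size s')) (leq_maxl _ _).
    by rewrite nth_default // leq_maxr.
  case: asboolP => [_|[]//].
  by case: (tau_top (last_one (nth false s'))) => // -[].
have /choice[Z ZP] : forall a, exists Z : set T, countable Z /\ (LL a ->
    countable [set y : T | trace (sval y) = a /\
    forall x, Z x -> ~ (agree (N x) (sval x) (sval y) /\ olt (h y) (h x))]).
  move=> a; have [/(fiber_lindelof N)[Z Zc ZP]|na] := pselect (LL a).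
    by exists Z.
  by exists set0.
exists (Q `|` \bigcup_(a in LL') Z a).
  by apply: countable_setU => //; apply: bigcup_countable => // a _; case: (ZP a).
pose W a := [set y : T | trace (sval y) = a /\
    forall x, Z a x -> ~ (agree (N x) (sval x) (sval y) /\ olt (h y) (h x))].
have Wc : countable (\bigcup_(a in LL') W a).
  by apply: bigcup_countable => // a [La _]; case: (ZP a) => _; apply.
apply: sub_countable (countable_setU Qc Wc); apply: subset_card_le => y yU.
have [ty|ny] := pselect (evconst (sval y)); first by left.
have Ly : LL (trace (sval y)) by case: (svalP y).
right; exists (trace (sval y)).
  split=> //; exists y => // x Qx; apply: yU; by left.
split=> // x Zx; apply: (yU x); right; exists (trace (sval y)) => //.
by split=> //; exists y => // x' Qx; apply: yU; left.
Qed.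

Let Y_card : is_card [set: Y] c.
Proof.
split; first exact: hc.1.
have [[f fi] [g gi]] := continuum_inj hc.
have [a [La _ _]] := @S_cofinal z xpred0 0 Jz.
pose w i := a i./2.
have wa : trace w = a.
  by apply/funext => j; rewrite /trace /w /= doubleK uphalf_double orbb.
have wu : unbounded (trace w) by rewrite wa; exact: LL_unbounded.
have [e ei eC] := uncountable_closed_inj (@fiber_closed _ _ _) (@fiber_uncountable w 0 wu).
have eP x : P (e x) by right; case: (eC x) => -> _; rewrite wa.
apply/card_eqPle; split; apply/card_le_injP.
  exists (fun p => exist _ (e (g p)) (eP (g p)) : Y) => p q /(congr1 sval)/=.
  by move/ei/gi.
exists (fun y : Y => f (sval (y : T))) => x y /fi xy.
by apply: eq_sig_hprop => // ?; exact: Prop_irrelevance.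
Qed.

Lemma ladder_construction : exists X : topologicalType,
  [/\ FLS X, separable X, special R X, is_card [set: X] c & scattered_height X lam].
Proof.
exists Y; split.
- split; [exact/smod_hausdorff/cantor_sub_hausdorff| |exact: Y_lindelof|].
    exact/smod_first_countable/cantor_sub_first_countable.
  exact: smod_scattered.
- apply: (smod_separable height_h z_min).
  have : countable [set x : T | evconst (sval x)] by exact: countable_points.
  apply: sub_countable; apply: subset_card_le => x hx.
  exact: ht_z_evconst (svalP x) hx.
- apply: smod_special => //; last exact: cantor_sub_metrizable.
  by have [x _] := bot_dense xpred0 0; exists x.
- exact: Y_card.
- exact: smod_scattered_height.
Qed.

End Construction.

(** The value for [t] is repeated infinitely often by coding pairs [(j, m)] with
   [f j = t] and arbitrary [m]. *)
Lemma top_enumeration (lam : Ord) (z : lam) (J : set lam) (Q : Prop) :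
  countable (~` J) -> ((forall t, J t) -> Q) ->
  exists tau : nat -> lam, (forall n, ~ J (tau n) \/ Q /\ tau n = z) /\
    forall t k, ~ J t -> exists n, (k <= n)%N /\ tau n = t.
Proof.
move=> cJ JQ; have [[t0 Jt0]|/forallNP nT] := pselect (exists t, ~ J t); last first.
  exists (fun=> z); split=> [n|t k /nT//]; right; split=> //; apply: JQ => t.
  by apply: contrapT; exact: nT.
have [f [fT fs]] := countable_enum (Jt0 : (~` J) t0) cJ.
exists (fun n => if choice.unpickle n is Some p then f (p : nat * nat).1 else f 0).
split=> [n|t k /fs[j fj]]; first by left; case: choice.unpickle => [p|]; exact: fT.
have [m km] := @injective_gtn (fun m => choice.pickle (j, m))
  (fun m m' e => congr1 snd (pcan_inj choice.pickleK e)) k.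
by exists (choice.pickle (j, m)); rewrite ltnW // choice.pickleK.
Qed.

Theorem theorem4p6 (R : realType) (c cplus kappa : Ord)
  (hc : is_card [set: set nat] c)
  (hcplus : is_succ_cardinal c cplus)
  (hkappa : ~ countable [set: kappa])
  (hL : exists2 L : set {ptws nat -> nat}, K_Lusin L & is_card L kappa)
  (lambda lim_lambda cf_lambda cf_lim_lambda : Ord)
  (hinf : infinite_set [set: lambda])
  (hlambda : ord_lt lambda cplus)
  (hcf : is_cf lambda cf_lambda)
  (hcf_omega : ord_le cf_lambda omega)
  (hlim : is_lim lambda lim_lambda)
  (hcf_lim : is_cf lim_lambda cf_lim_lambda)
  (hcf_kappa : ord_le cf_lim_lambda kappa) :
  exists X : topologicalType,
    [/\ FLS X, separable X, special R X, is_card [set: X] c &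
        scattered_height X lambda].
Proof.
have [u u_inj] := lt_succ_cardinal_inj hcplus hlambda.
have [i i_emb i_fin] := is_lim_embedding hlim.
have i_inj : injective i by case: i_emb => im _; exact: olt_mono_inj im.
have nomax := limit_nomax hlim.1.
have [x0 _] : [set: lim_lambda] !=set0.
  apply: contrapT => n0; apply: hinf; apply: sub_finite_set i_fin => y _ [x _ _].
  by apply: n0; exists x.
have [z _ z_min0] := @olt_min lambda setT (i x0) Logic.I.
have z_min y : ole z y by exact: z_min0.
have J_down x y : range i y -> olt x y -> range i x.
  by move=> [w _ <-] /i_emb.2[v vx]; exists v.
have Jz : range i z.
  by case: (z_min (i x0)) => [|->]; [apply: J_down|]; exists x0.
have [LL [S [ladders LL_count]]] : exists LL S, ladder_system z (range i) LL S /\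
    ((forall t, range i t) -> countable LL).
  have [[A [cA cofA]]|unc] := pselect (exists A : set lim_lambda, countable A /\ cofinal A).
    have [LL [S [lad cLL]]] := countable_cofinal_ladders i_emb z_min nomax x0 cA cofA.
    by exists LL, S.
  have [L KL [_ kL]] := hL; have [[A cofA [_ cfA]] _] := hcf_lim.
  have AL : A #<= L.
    have /card_eqPle[_ Acf] := cfA; have /card_eqPle[kL' _] := kL.
    apply: card_le_trans kL'; apply: card_le_trans Acf _.
    exact/card_le_injP/ord_le_inj.
  have uncof (B : set lim_lambda) : countable B -> ~ cofinal B.
    by move=> cB cofB; apply: unc; exists B.
  have [LL [S lad]] := K_Lusin_ladders i_emb z_min nomax KL AL cofA uncof.
  exists LL, S; split=> // all_i; exfalso.
  (* Here [lambda] is the limit itself, and its countable cofinality pulls back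
     along [i]. *)
  have [[B cofB [_ cfB]] _] := hcf.
  apply: (uncof (i @^-1` B)) => [|x].
    have /card_eqPle[_ Bcf] := cfB.
    have cB : countable B.
      apply: card_le_trans Bcf _; apply/card_le_injP.
      exact: ord_le_inj hcf_omega.
    have /countable_injP[g gi] := cB; apply/countable_injP; exists (g \o i).
    move=> x y /set_mem Bx /set_mem By e; apply: i_inj.
    by apply: gi e; exact: mem_set.
  have [y By xy] := cofB (i x); have [w _ wy] := all_i y; exists w.
    by rewrite /= wy.
  by rewrite -wy in xy; case: xy => [/(olt_monoE (proj1 i_emb))|/i_inj]; [left|right].
have [tau [tau_top tau_onto]] := top_enumeration z (finite_set_countable i_fin) LL_count.
have [b bP] := bernstein hc z u_inj.
exact: (ladder_construction R hc z_min Jz J_down ladders tau_top tau_onto bP).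
Qed.
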